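(* Let $d\geq 2$, let $\mathbb{D}^d$ be the open unit polydisk in $\mathbb{C}^d$, and let $f: \mathbb{D}^d \to \mathbb{D}$ be holomorphic. Then for each nonempty $S \subsetneq \{1,2,\dots,d\}$ there exist positive semi-definite $S$-contractive kernels $K_S, L_S:\mathbb{D}^d\times\mathbb{D}^d\to\mathbb{C}$ such that the following hold. (1) Whenever $S \sqcup T = \{1,\dots,d\}$ is a partition with $S$ and $T$ both nonempty, $$\frac{1-f(z)\overline{f(\zeta)}}{\prod_{j=1}^d (1-z_j\bar{\zeta}_j)} = K_S(z,\zeta) + L_T(z,\zeta)\qquad (z,\zeta\in\mathbb{D}^d)$$ and $$K_T - L_T = K_S - L_S \geq 0.$$ (2) Whenever $S \subset S'$ are nonempty proper subsets of $\{1,2,\dots,d\}$, $K_S \geq K_{S'}$.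
   Context: A function $K:\mathbb{D}^d\times\mathbb{D}^d\to\mathbb{C}$ is a positive semi-definite kernel, written $K\geq 0$, if for every finite subset $F\subset\mathbb{D}^d$ the matrix $(K(z,\zeta))_{z,\zeta\in F}$ is positive semi-definite. For two kernels, $K\geq L$ means $K-L\geq 0$. A positive semi-definite kernel $K$ is $j$-contractive if $(1-z_j\bar{\zeta}_j)K(z,\zeta)\geq 0$ (as a kernel in $(z,\zeta)$); for $S\subset\{1,\dots,d\}$, it is $S$-contractive if it is $j$-contractive for every $j\in S$. *)

(* Defs.v *)
From HB Require Import structures.
From mathcomp Require Import all_boot all_order all_algebra.
From mathcomp Require Import all_classical all_reals topology normedtype derive.
From mathcomp Require Import complex.
Set Implicit Arguments.
Unset Strict Implicit.
Unset Printing Implicit Defensive.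
Import Order.TTheory GRing.Theory Num.Theory.
Import numFieldNormedType.Exports.
Local Open Scope classical_set_scope.
Local Open Scope sesquilinear_scope.
Local Open Scope ring_scope.

(* The definitions are stated over an abstract numClosedFieldType C, so that C
   and 'rV[C]_d carry their normed module structures over C; they are meant to
   be used at C := R[i] with R : realType. *)

Definition polydisk (C : numClosedFieldType) (d : nat) : set 'rV[C]_d :=
  [set z | forall j : 'I_d, `|z ord0 j| < 1].

(* [differentiable] is Frechet differentiability over the scalar field C, that
   is, complex differentiability. *)
Definition holomorphic_on (C : numClosedFieldType) (d : nat)
    (U : set 'rV[C]_d) (f : 'rV[C]_d -> C) : Prop :=
  forall z, U z -> differentiable f z.

(* In C, [0 <= x] means that x is real and nonnegative, so that the condition
   below also forces A to be Hermitian. *)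
Definition psdmx (C : numClosedFieldType) (n : nat) (A : 'M[C]_n) : Prop :=
  forall v : 'rV[C]_n, 0 <= (v *m A *m v ^t*) ord0 ord0.

(* Kernels are total functions, but only their values on pairs of points of the
   polydisk are ever constrained. *)
Definition kernel (C : numClosedFieldType) (d : nat) : Type :=
  'rV[C]_d -> 'rV[C]_d -> C.

(* The injective p enumerates a finite subset of the polydisk. *)
Definition psd_kernel (C : numClosedFieldType) (d : nat) (K : kernel C d) :
    Prop :=
  forall (n : nat) (p : 'I_n -> 'rV[C]_d),
    injective p -> (forall i, polydisk (p i)) ->
    psdmx (\matrix_(i < n, j < n) K (p i) (p j)).

Definition kernel_ge (C : numClosedFieldType) (d : nat) (K L : kernel C d) :
    Prop :=
  psd_kernel (fun z w => K z w - L z w).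

Definition contractive_at (C : numClosedFieldType) (d : nat) (j : 'I_d)
    (K : kernel C d) : Prop :=
  psd_kernel (fun z w => (1 - z ord0 j * (w ord0 j)^*) * K z w).

Definition contractive (C : numClosedFieldType) (d : nat) (S : {set 'I_d})
    (K : kernel C d) : Prop :=
  forall j, j \in S -> contractive_at j K.

(* Main.v *)
(** For a set T of directions let H_T be the trigonometric polynomials whose
    frequencies are nonnegative in the directions of T, let P_+ be the projection
    onto the frequencies nonnegative in every direction, and P_- = 1 - P_+.
    When f is a polynomial with |f| <= rho < 1 on the torus, then for h in H^2
      J_T(h) = sup_{x in H_T} 2 Re <h, f x> - |x|^2 + |P_- (f x)|^2
    is a quadratic form in h, that is, a kernel.  With T the complement of S,
    K_S = Szego - J_T is the infimum of |h - P_+ (f x)|^2 + |x|^2 - |f x|^2; it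
    decreases under the backward shifts in the directions of S because H_T is
    invariant under these bilateral shifts.  The part of x in H^2 contributes
    exactly |M_f^* h|^2 to the supremum, so that L_T = J_T - f f^* Szego is a
    supremum over the functions of H_T with no frequency in the nonnegative
    orthant, a space invariant under the forward shifts in the directions of T.
    Since f contracts L^2, J_T <= Szego and J_S + J_T <= Szego + f f^* Szego.

    All these conditions are closed under pointwise limits, and f is the pointwise
    limit of polynomials bounded by constants < 1 on the torus: Cauchy's formula,
    read as a limit of averages over 2^m-th roots of unity, makes interpolation at
    these roots converge uniformly, one variable at a time. *)

Require Import Defs.
From HB Require Import structures.
From mathcomp Require Import all_boot all_order all_algebra.
From mathcomp Require Import all_classical all_reals topology normedtype derive.
From mathcomp Require Import complex.
From mathcomp Require Import landau ring lra sequences trigo.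
Set Implicit Arguments.
Unset Strict Implicit.
Unset Printing Implicit Defensive.
Import Order.TTheory GRing.Theory Num.Theory.
Import numFieldNormedType.Exports.
Local Open Scope ring_scope.
Local Notation "x %:C" := (real_complex _ x).

(** * Discrete contour sums and Goursat's bisection *)

(** Two obstacles shape the proof. A supremum of quadratic forms is in general not a quadratic form.
    The bound rho < 1 makes |x|^2 - |P_- (f x)|^2 positive definite; over a finite-dimensional space
    the supremum is then attained and given by an inverse Gram matrix, visibly a kernel. These
    kernels lie between 0 and the Szego kernel, polarization bounds their entries, and one
    ultrafilter yields limits at all pairs of points at once. The same device passes from
    polynomials to f. The other obstacle is that no integral is used. L^2 of the torus is replaced
    by finitely supported coefficients on Z^d, multiplication by convolution, and the contraction
    property comes from Parseval's identity on finite grids fine enough for the frequencies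
    involved. Cauchy's theorem concerns trapezoid sums: halving a square goes with halving the
    number of nodes on its sides, so bisection runs on sums at infinitely many scales together. *)

Definition cdiff (C : numFieldType) (h : C -> C) (c : C) : Prop :=
  differentiable h c.

Lemma differentiable_cE (C : numFieldType) (h : C -> C) (c : C) :
  cdiff h c ->
  exists L : C, forall e : C, 0 < e -> exists2 d : C, 0 < d &
    forall z, `|z - c| < d -> `|h z - (h c + L * (z - c))| <= e * `|z - c|.
Proof.
move=> dh; exists (derive1 h c) => e e0.
have /derivable1_diffP dh1 := dh.
have := diff_locally dh; rewrite diff1E// => /eqaddoP /(_ _ e0).
rewrite /= -nbhs_nearE => /nbhs_ballP[d /= d0 dP].
exists d => // z zc.
have := dP (z - c); rewrite /ball /= sub0r normrN => /(_ zc).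
by rewrite !fctE /= subrK [_ *: _]mulrC.
Qed.

Section Goursat.
Variable R : realType.
Local Notation C := R[i].
Implicit Types (h : C -> C) (g : R -> C) (z : R -> R -> C).

(** The trapezoid rule, exact on affine functions: their contour sums vanish at every scale, with no
    error term. *)
Definition edge h (u v : C) : C := (h u + h v) / 2 * (v - u).

Definition path_sum h g (n : nat) (a l : R) : C :=
  \sum_(i < n) edge h (g (a + l * i%:R / n%:R)) (g (a + l * i.+1%:R / n%:R)).

Definition contour h z (n : nat) (s t l : R) : C :=
  path_sum h (z^~ t) n s l + path_sum h (z (s + l)) n t l
  - path_sum h (z^~ (t + l)) n s l - path_sum h (z s) n t l.

Lemma path_sum_split h g n a l : (0 < n)%N ->
  path_sum h g (n + n) a l =
  path_sum h g n a (l / 2) + path_sum h g n (a + l / 2) (l / 2).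
Proof.
move=> n0; have n00 : n%:R != 0 :> R by rewrite pnatr_eq0 -lt0n.
have E i : a + l * i%:R / (n + n)%:R = a + l / 2 * i%:R / n%:R.
  by rewrite addnn -mul2n natrM; field.
have E2 i : a + l * (n + i)%:R / (n + n)%:R = a + l / 2 + l / 2 * i%:R / n%:R.
  by rewrite addnn -mul2n natrM natrD; field.
rewrite /path_sum big_split_ord /=; congr (_ + _); apply: eq_bigr => i _.
  by rewrite !E.
by rewrite -addnS !E2.
Qed.

(** With twice the nodes on a side twice as long, neighbouring small squares share the nodes of
    their common side, and the interior contributions cancel exactly. *)
Lemma contour_split h z n s t l : (0 < n)%N ->
  contour h z (n + n) s t l =
  contour h z n s t (l / 2) + contour h z n (s + l / 2) t (l / 2)
  + contour h z n s (t + l / 2) (l / 2)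
  + contour h z n (s + l / 2) (t + l / 2) (l / 2).
Proof.
move=> n0; rewrite /contour !path_sum_split//.
have -> : s + l / 2 + l / 2 = s + l by field.
have -> : t + l / 2 + l / 2 = t + l by field.
ring.
Qed.

Lemma path_sum_affine g n a l (A B : C) : (0 < n)%N ->
  path_sum (fun u => A + B * u) g n a l =
  (A * g (a + l) + B * g (a + l) ^+ 2 / 2) - (A * g a + B * g a ^+ 2 / 2).
Proof.
move=> n0; have n00 : n%:R != 0 :> R by rewrite pnatr_eq0 -lt0n.
pose F i := A * g (a + l * i%:R / n%:R) + B * g (a + l * i%:R / n%:R) ^+ 2 / 2.
rewrite /path_sum (eq_bigr (fun i : 'I_n => F i.+1 - F i)); last first.
  by move=> i _; rewrite /edge /F; field.
rewrite -(big_mkord xpredT (fun i => F i.+1 - F i)) telescope_sumr//.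
by rewrite /F mulr0 mul0r addr0 mulfK.
Qed.

Lemma contour_affine z n s t l (A B : C) : (0 < n)%N ->
  contour (fun u => A + B * u) z n s t l = 0.
Proof. by move=> n0; rewrite /contour !path_sum_affine//; ring. Qed.

Lemma path_sumB h k g n a l :
  path_sum (fun u => h u - k u) g n a l = path_sum h g n a l - path_sum k g n a l.
Proof.
by rewrite /path_sum -sumrB; apply: eq_bigr => i _; rewrite /edge; field.
Qed.

Lemma contourB h k z n s t l :
  contour (fun u => h u - k u) z n s t l =
  contour h z n s t l - contour k z n s t l.
Proof. by rewrite /contour !path_sumB; ring. Qed.

Lemma path_sum_le h g n a l (e : C) (K : R) : (0 < n)%N -> 0 <= l -> 0 <= e ->
  (forall x, a <= x <= a + l -> `|h (g x)| <= e) ->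
  (forall x y, a <= x <= a + l -> a <= y <= a + l ->
     `|g y - g x| <= (K * `|y - x|)%:C) ->
  `|path_sum h g n a l| <= e * (K * l)%:C.
Proof.
move=> n0 l0 e0 hle gle; have n00 : n%:R != 0 :> R by rewrite pnatr_eq0 -lt0n.
have n0R : 0 < n%:R :> R by rewrite ltr0n.
have in_itv i : (i <= n)%N -> a <= a + l * i%:R / n%:R <= a + l.
  move=> lein; rewrite lerDl lerD2l -mulrA !mulr_ge0 ?invr_ge0 ?ler0n//=.
  by rewrite ler_piMr// ler_pdivrMr// mul1r ler_nat.
apply: le_trans (ler_norm_sum _ _ _) _.
apply: le_trans (_ : \sum_(i < n) e * (K * (l / n%:R))%:C <= _).
  apply: ler_sum => i _; rewrite normrM; apply: ler_pM => //.
    rewrite normrM normfV normr_nat ler_pdivrMr// [e * _]mulr_natr.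
    apply: le_trans (ler_normD _ _) _; rewrite mulr2n.
    by apply: lerD; apply: hle; rewrite in_itv// ltnW.
  apply: le_trans (gle _ _ _ _) _; rewrite ?in_itv// 1?ltnW//.
  rewrite lecR.
  have -> : a + l * i.+1%:R / n%:R - (a + l * i%:R / n%:R) = l / n%:R.
    by rewrite -natr1; field.
  by rewrite ger0_norm// mulr_ge0// invr_ge0 ler0n.
rewrite sumr_const card_ord -mulrnAr -rmorphMn.
suff -> : (K * (l / n%:R)) *+ n = K * l by [].
by rewrite -mulr_natr; field.
Qed.

Lemma contour_le h z n s t l (e : C) (K : R) : (0 < n)%N -> 0 <= l -> 0 <= e ->
  (forall x y, s <= x <= s + l -> t <= y <= t + l -> `|h (z x y)| <= e) ->
  (forall x y x' y', s <= x <= s + l -> t <= y <= t + l ->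
     s <= x' <= s + l -> t <= y' <= t + l ->
     `|z x' y' - z x y| <= (K * (`|x' - x| + `|y' - y|))%:C) ->
  `|contour h z n s t l| <= 4 * (e * (K * l)%:C).
Proof.
move=> n0 l0 e0 hle zle.
have [s1 s2 t1 t2] : [/\ s <= s <= s + l, s <= s + l <= s + l,
    t <= t <= t + l & t <= t + l <= t + l] by rewrite !lexx !lerDl l0.
have -> : 4 * (e * (K * l)%:C) = e * (K * l)%:C + e * (K * l)%:C
  + e * (K * l)%:C + e * (K * l)%:C by ring.
have hor y : t <= y <= t + l -> `|path_sum h (z^~ y) n s l| <= e * (K * l)%:C.
  move=> yI; apply: path_sum_le => // [x xI|x x' xI x'I]; first exact: hle.
  by apply: le_trans (zle _ _ _ _ _ _ _ _) _ => //; rewrite subrr normr0 addr0.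
have ver x : s <= x <= s + l -> `|path_sum h (z x) n t l| <= e * (K * l)%:C.
  move=> xI; apply: path_sum_le => // [y yI|y y' yI y'I]; first exact: hle.
  by apply: le_trans (zle _ _ _ _ _ _ _ _) _ => //; rewrite subrr normr0 add0r.
rewrite /contour; apply: le_trans (ler_normB _ _) _; apply: lerD; last exact: ver.
apply: le_trans (ler_normB _ _) _; apply: lerD; last exact: hor.
by apply: le_trans (ler_normD _ _) _; apply: lerD; [exact: hor|exact: ver].
Qed.

Lemma nested_intervals (s : nat -> R) :
  (forall k, s k <= s k.+1) ->
  (forall k, s k.+1 + 2^-1 ^+ k.+1 <= s k + 2^-1 ^+ k) ->
  exists x, forall k, s k <= x <= s k + 2^-1 ^+ k.
Proof.
move=> s_le s_ge.
have s_homo : {homo s : m n / (m <= n)%N >-> m <= n} by apply: homo_leq => //; exact: le_trans.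
have e_homo : {homo (fun k => s k + 2^-1 ^+ k) : m n / (m <= n)%N >-> n <= m}.
  by apply: homo_leq => // y x w; move=> ? /le_trans; apply.
have cross j k : s j <= s k + 2^-1 ^+ k.
  have p0 i : 0 <= 2^-1 ^+ i :> R by rewrite exprn_ge0// invr_ge0.
  have [jk|/ltnW kj] := leqP j k.
    by apply: le_trans (s_homo _ _ jk) _; rewrite lerDl.
  by apply: le_trans (e_homo _ _ kj); rewrite lerDl.
exists (sup (range s)) => k; apply/andP; split.
  apply: ub_le_sup; last by exists k.
  by exists (s 0%N + 2^-1 ^+ 0) => _ [j _ <-].
by apply: ge_sup; [exists (s 0%N); exists 0%N|move=> _ [j _ <-]].
Qed.

(* Goursat's bisection, carried out on discrete contour sums at all fine
   enough scales simultaneously, so that no line integral is needed. *)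
Theorem discrete_Goursat h z (K : R) : 0 < K ->
  (forall s t, 0 <= s <= 1 -> 0 <= t <= 1 -> cdiff h (z s t)) ->
  (forall s t s' t', 0 <= s <= 1 -> 0 <= t <= 1 -> 0 <= s' <= 1 -> 0 <= t' <= 1 ->
     `|z s' t' - z s t| <= (K * (`|s' - s| + `|t' - t|))%:C) ->
  forall c : C, 0 < c ->
  exists N, forall m, (N <= m)%N -> `|contour h z (2 ^ m) 0 0 1| < c.
Proof.
move=> K0 dh zle c c0.
(* A bad square has a large contour sum at infinitely many scales [m]. If all four children were
   eventually small, so would be the parent; each subdivision lowers [m] by one. *)
pose bad (k : nat) (p : R * R) := forall N, exists2 m, (N <= m)%N &
  c * 4^-1 ^+ k <= `|contour h z (2 ^ m) p.1 p.2 (2^-1 ^+ k)|.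
apply: contrapT => ngood.
have bad0 : bad 0%N (0, 0).
  move=> N; apply: contrapT => nN; apply: ngood; exists N => m Nm.
  rewrite real_ltNge ?normr_real ?gtr0_real//; apply/negP => cm.
  by apply: nN; exists m => //; rewrite !expr0 mulr1.
pose child (k : nat) (p q : R * R) :=
  (q.1 = p.1 \/ q.1 = p.1 + 2^-1 ^+ k.+1) /\ (q.2 = p.2 \/ q.2 = p.2 + 2^-1 ^+ k.+1).
have bad_child k p : exists q, bad k p -> bad k.+1 q /\ child k p q.
  have [badp|] := EM (bad k p); last by exists p.
  apply: contrapT => nq.
  have good q : child k p q -> exists N, forall m, (N <= m)%N ->
      `|contour h z (2 ^ m) q.1 q.2 (2^-1 ^+ k.+1)| < c * 4^-1 ^+ k.+1.
    move=> cq; apply: contrapT => ng; apply: nq; exists q => _; split => // N.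
    apply: contrapT => nN; apply: ng; exists N => m Nm.
    rewrite real_ltNge ?normr_real ?gtr0_real//; last first.
      by rewrite mulr_gt0// exprn_gt0// invr_gt0.
    by apply/negP => cm; apply: nN; exists m.
  have [N1 g1] := good (p.1, p.2) (conj (or_introl erefl) (or_introl erefl)).
  have [N2 g2] := good (p.1 + 2^-1 ^+ k.+1, p.2) (conj (or_intror erefl) (or_introl erefl)).
  have [N3 g3] := good (p.1, p.2 + 2^-1 ^+ k.+1) (conj (or_introl erefl) (or_intror erefl)).
  have [N4 g4] := good (p.1 + 2^-1 ^+ k.+1, p.2 + 2^-1 ^+ k.+1)
    (conj (or_intror erefl) (or_intror erefl)).
  have [[|m]] := badp (N1 + N2 + N3 + N4).+1 => //; rewrite ltnS => Nm.
  rewrite expnS mul2n -addnn contour_split ?expn_gt0//.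
  have -> : 2^-1 ^+ k / 2 = 2^-1 ^+ k.+1 :> R by rewrite exprSr.
  apply/negP; rewrite -real_ltNge ?normr_real//; last first.
    by rewrite gtr0_real// mulr_gt0// exprn_gt0// invr_gt0.
  have -> : c * 4^-1 ^+ k = c * 4^-1 ^+ k.+1 + c * 4^-1 ^+ k.+1
      + c * 4^-1 ^+ k.+1 + c * 4^-1 ^+ k.+1 by rewrite exprSr; field.
  have [l1 l2 l3 l4] : [/\ (N1 <= m)%N, (N2 <= m)%N, (N3 <= m)%N & (N4 <= m)%N].
    by split; apply: leq_trans Nm; rewrite -?addnA ?leq_addr//;
      do ?[rewrite leq_addr // | apply: leq_trans (leq_addl _ _)].
  apply: le_lt_trans (ler_normD _ _) _; apply: ltrD; last exact: g4.
  apply: le_lt_trans (ler_normD _ _) _; apply: ltrD; last exact: g3.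
  by apply: le_lt_trans (ler_normD _ _) _; apply: ltrD; [exact: g1|exact: g2].
have [next nextP] := choice (fun kp : nat * (R * R) => bad_child kp.1 kp.2).
pose u := fix u k := if k is k'.+1 then next (k', u k') else (0, 0).
have badu k : bad k (u k).
  by elim: k => // k IH; have [] := nextP (k, u k) IH.
have chu k : child k (u k) (u k.+1) by have [] := nextP (k, u k) (badu k).
have p0 i : 0 < 2^-1 ^+ i :> R by rewrite exprn_gt0// invr_gt0.
have half k : 2^-1 ^+ k = 2^-1 ^+ k.+1 + 2^-1 ^+ k.+1 :> R by rewrite exprS; field.
have [s sP] : exists x, forall k, (u k).1 <= x <= (u k).1 + 2^-1 ^+ k.
  by apply: nested_intervals => k; have [[->|->] _] := chu k; have := p0 k.+1;
    rewrite ?(half k); lra.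
have [t tP] : exists x, forall k, (u k).2 <= x <= (u k).2 + 2^-1 ^+ k.
  by apply: nested_intervals => k; have [_ [->|->]] := chu k; have := p0 k.+1;
    rewrite ?(half k); lra.
have inu k : [/\ 0 <= (u k).1, (u k).1 + 2^-1 ^+ k <= 1, 0 <= (u k).2
    & (u k).2 + 2^-1 ^+ k <= 1].
  elim: k => [|k [a1 a2 a3 a4]]; first by rewrite /= expr0; split; lra.
  have [e1 e2] := chu k; have h1 := p0 k.+1; have h2 := half k.
  clear - a1 a2 a3 a4 e1 e2 h1 h2.
  by case: e1 => ->; case: e2 => ->; split; lra.
have s01 : 0 <= s <= 1 by have := sP 0%N; rewrite /= expr0; lra.
have t01 : 0 <= t <= 1 by have := tP 0%N; rewrite /= expr0; lra.
have [L LP] := differentiable_cE (dh _ _ s01 t01).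
have K2 : 0 < (K ^+ 2)%:C :> C by rewrite ltcR exprn_gt0.
(* The final estimate is [4 * (e * (2 * K * 2^-1 ^+ k) * (K * 2^-1 ^+ k))], which for this [e] is
   half of [c * 4^-1 ^+ k]. *)
pose e : C := c / (16 * (K ^+ 2)%:C).
have e0 : 0 < e by rewrite divr_gt0// mulr_gt0.
have [d d0 dP] := LP e e0.
have [k kd] : exists k, (2 * K * 2^-1 ^+ k)%:C < d.
  have Rd : 0 < complex.Re d by move: d0; rewrite ltcE => /andP[].
  have dE : d = (complex.Re d)%:C by rewrite RRe_real// gtr0_real.
  have x0 : 0 < complex.Re d / (2 * K) by rewrite divr_gt0// mulr_gt0.
  exists (Num.bound (complex.Re d / (2 * K))^-1).
  rewrite dE ltcR exprVn mulrC ltr_pdivrMl ?exprn_gt0//.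
  rewrite -ltr_pdivrMr// -[X in X < _]invf_div.
  have /archi_boundP h1 : 0 <= (complex.Re d / (2 * K))^-1 by rewrite invr_ge0 ltW.
  by apply: lt_trans h1 _; rewrite -natrX ltr_nat ltn_expl.
have zle' x y : (u k).1 <= x <= (u k).1 + 2^-1 ^+ k ->
    (u k).2 <= y <= (u k).2 + 2^-1 ^+ k -> `|z x y - z s t| <= (2 * K * 2^-1 ^+ k)%:C.
  move=> xI yI; have [a1 a2 a3 a4] := inu k.
  apply: le_trans (zle s t x y s01 t01 _ _) _;
    [clear - a1 a2 xI; lra|clear - a3 a4 yI; lra|].
  rewrite lecR [X in _ <= X](_ : _ = K * (2^-1 ^+ k + 2^-1 ^+ k)); last ring.
  rewrite ler_pM2l//.
  have sk : `|x - s| <= 2^-1 ^+ k by rewrite ler_norml; have sk := sP k; clear - sk xI; lra.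
  have tk : `|y - t| <= 2^-1 ^+ k by rewrite ler_norml; have tk := tP k; clear - tk yI; lra.
  by clear - sk tk; lra.
have [m _] := badu k 0%N.
apply/negP; rewrite -real_ltNge ?normr_real//; last first.
  by rewrite gtr0_real// mulr_gt0// exprn_gt0// invr_gt0.
pose aff (w : C) := h (z s t) - L * z s t + L * w.
have -> : contour h z (2 ^ m) (u k).1 (u k).2 (2^-1 ^+ k) =
    contour (fun w => h w - aff w) z (2 ^ m) (u k).1 (u k).2 (2^-1 ^+ k).
  by rewrite contourB contour_affine ?expn_gt0// subr0.
apply: le_lt_trans (@contour_le _ _ _ _ _ _ (e * (2 * K * 2^-1 ^+ k)%:C) K _ _ _ _ _) _.
- by rewrite expn_gt0.
- exact: ltW.
- by rewrite mulr_ge0 ?(ltW e0)// lecR !mulr_ge0// ltW.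
- move=> x y xI yI; have zd := zle' _ _ xI yI.
  have -> : h (z x y) - aff (z x y) = h (z x y) - (h (z s t) + L * (z x y - z s t)).
    by rewrite /aff; ring.
  apply: le_trans (dP _ (le_lt_trans zd kd)) _.
  by rewrite ler_pM2l.
- move=> x y x' y' xI yI x'I y'I; have [a1 a2 a3 a4] := inu k.
  by apply: zle; clear - a1 a2 a3 a4 xI yI x'I y'I; lra.
have -> : 4 * (e * (2 * K * 2^-1 ^+ k)%:C * (K * 2^-1 ^+ k)%:C) =
    c * 4^-1 ^+ k / 2 :> C.
  have -> : 4^-1 ^+ k = (2^-1 ^+ k)%:C * (2^-1 ^+ k)%:C :> C.
    rewrite -rmorphM /= -exprMn -invfM -natrM rmorphXn /= fmorphV /= rmorph_nat //.
  have Kne : K%:C != 0 :> C by rewrite gt_eqF// ltcR.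
  rewrite /e !rmorphM /= rmorph_nat rmorphXn /=; field.
  by rewrite Kne.
rewrite ltr_pdivrMr// mulr_natr mulr2n ltrDl mulr_gt0// exprn_gt0// invr_gt0//.
Qed.

End Goursat.

(** * Roots of unity on the unit circle *)

Lemma cdiff_quotient (C : numFieldType) (g : C -> C) (w z : C) :
  cdiff g z -> z != w -> cdiff (fun x => (g x - g w) / (x - w)) z.
Proof.
move=> dg zw; apply: differentiableM.
  by apply: differentiableB => //; exact: differentiable_cst.
apply: (@differentiableV _ _ (fun x => x - w)); last by rewrite subr_eq0.
by apply: differentiableB => //; exact: differentiable_cst.
Qed.

Section RootSums.
Variables (F : fieldType) (n : nat) (om : F).
Hypothesis (om_prim : n.-primitive_root om) (n0 : n%:R != 0 :> F).

Lemma prim_root_sum0 (j : nat) : ~~ (n %| j)%N -> \sum_(k < n) om ^+ (j * k) = 0.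
Proof.
move=> nj; have omj : om ^+ j - 1 != 0 by rewrite subr_eq0 -(prim_order_dvd om_prim).
apply: (mulfI omj); rewrite mulr0.
rewrite (eq_bigr (fun k : 'I_n => (om ^+ j) ^+ k)) => [|k _]; last by rewrite exprM.
by rewrite -subrX1 -exprM mulnC exprM (prim_expr_order om_prim) expr1n subrr.
Qed.

(** Multiplied by [1 - t ^+ n], each fraction [1 / (1 - t * om ^+ k)] becomes a geometric sum of
    length [n]; averaging against [om ^- (j * k)] keeps only its term of degree [j]. *)
Lemma prim_root_geom_avg (t : F) (j : nat) : t ^+ n != 1 ->
  (forall k, t * om ^+ k != 1) -> (j < n)%N ->
  n%:R^-1 * \sum_(k < n) om ^- (j * k) / (1 - t * om ^+ k) = t ^+ j / (1 - t ^+ n).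
Proof.
move=> tn1 tk1 jn.
have npos : (0 < n)%N by apply: leq_trans jn.
have tn0 : 1 - t ^+ n != 0 by rewrite subr_eq0 eq_sym.
have om0 : om != 0 by apply: contraNneq n0 => om0;
  have := prim_expr_order om_prim; rewrite om0 expr0n; case: (n) npos => // n' _ /eqP;
  rewrite eq_sym oner_eq0.
have E k : om ^- (j * k) / (1 - t * om ^+ k) =
    (1 - t ^+ n)^-1 * \sum_(m < n) t ^+ m * (om ^+ (m * k) / om ^+ (j * k)).
  have k0 : 1 - t * om ^+ k != 0 by rewrite subr_eq0 eq_sym.
  have tE : (t * om ^+ k) ^+ n = t ^+ n.
    by rewrite exprMn -exprM mulnC exprM (prim_expr_order om_prim) expr1n mulr1.
  have : 1 - t ^+ n = (1 - t * om ^+ k) * \sum_(m < n) (t * om ^+ k) ^+ m.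
    by rewrite -tE -opprB subrX1 -mulNr opprB.
  move=> tnE; apply: (mulfI k0); rewrite mulrCA divff// mulr1.
  rewrite [RHS]mulrCA; apply: (mulfI tn0); rewrite mulVKf// tnE -mulrA; congr (_ * _).
  rewrite mulr_suml; apply: eq_bigr => m _.
  by rewrite exprMn -exprM mulrA [(k * m)%N]mulnC.
rewrite (eq_bigr _ (fun k _ => E (val k))) -mulr_sumr exchange_big /=.
rewrite (bigD1 (Ordinal jn))//= [\sum_(i < n | i != _) _]big1 ?addr0 => [|m mj].
  rewrite (eq_bigr (fun=> t ^+ j)) => [|k _]; last by rewrite divff ?mulr1// expf_neq0.
  by rewrite sumr_const card_ord -[_ *+ _]mulr_natl; field; rewrite n0 tn0.
rewrite -mulr_sumr.
suff -> : \sum_(i < n) om ^+ (m * i) / om ^+ (j * i) = 0 by rewrite mulr0.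
have mj' : ~~ (n %| m + (n - j))%N.
  apply: contra mj => dv; apply/eqP/val_inj => /=.
  have : (m + (n - j) == j + (n - j) %[mod n])%N.
    by rewrite subnKC ?(ltnW jn)// modnn; move: dv; rewrite /dvdn.
  by rewrite eqn_modDr !modn_small// => /eqP.
apply: etrans (prim_root_sum0 mj'); apply: eq_bigr => i _.
rewrite mulnDl exprD mulnBl; congr (_ * _).
apply: (mulfI (expf_neq0 (j * i) om0)).
by rewrite divff ?expf_neq0// -exprD subnKC ?leq_mul2r ?(ltnW jn) ?orbT// exprM
  (prim_expr_order om_prim) expr1n.
Qed.

End RootSums.

Section Expi.
Variable R : realType.
Local Notation C := R[i].

Definition expi (x : R) : C := Complex (cos x) (sin x).

Lemma expiD x y : expi (x + y) = expi x * expi y.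
Proof.
by apply/eqP; rewrite eq_complex /= cosD sinD eqxx /= addrC.
Qed.

Lemma expi0 : expi 0 = 1.
Proof. by rewrite /expi cos0 sin0. Qed.

Lemma expi_natmul x n : expi (n%:R * x) = expi x ^+ n.
Proof.
elim: n => [|n IH]; first by rewrite mul0r expi0.
by rewrite -natr1 mulrDl mul1r expiD IH exprSr.
Qed.

Lemma norm_expi x : `|expi x| = 1.
Proof. by rewrite normc_def /= cos2Dsin2 sqrtr1. Qed.

Lemma le_normReIm (a b : R) : `|Complex a b| <= (`|a| + `|b|)%:C :> C.
Proof.
rewrite normc_def lecR /= -[leRHS]ger0_norm ?addr_ge0// -sqrtr_sqr ler_wsqrtr//.
rewrite sqrrD !real_normK ?num_real// lerD2r lerDl mulrn_wge0// mulr_ge0//.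
Qed.

Lemma cos_lip (x y : R) : `|cos x - cos y| <= `|x - y|.
Proof.
wlog yx : x y / y <= x => [H|].
  by case/orP: (le_total y x) => [/H//|/H]; rewrite distrC [`|y - x|]distrC.
have [|c _ ->] := @MVT_segment _ cos (- sin) _ _ yx.
  by apply: continuous_subspaceT; exact: continuous_cos.
by rewrite normrM fctE normrN ler_piMl// ler_norml sin_le1 sin_geN1.
Qed.

Lemma sin_lip (x y : R) : `|sin x - sin y| <= `|x - y|.
Proof.
wlog yx : x y / y <= x => [H|].
  by case/orP: (le_total y x) => [/H//|/H]; rewrite distrC [`|y - x|]distrC.
have [|c _ ->] := @MVT_segment _ sin cos _ _ yx.
  by apply: continuous_subspaceT; exact: continuous_sin.
by rewrite normrM ler_piMl// ler_norml cos_le1 cos_geN1.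
Qed.

Lemma expi_lip x y : `|expi x - expi y| <= (2 * `|x - y|)%:C.
Proof.
apply: le_trans (le_normReIm _ _) _.
by rewrite lecR mulr_natl mulr2n lerD ?cos_lip ?sin_lip.
Qed.

Definition om (m : nat) : C := expi (2 * pi / (2 ^ m)%:R).

Lemma expi2pi : expi (2 * pi) = 1.
Proof. by rewrite /expi mulr_natl cos2pi sin2pi. Qed.

Lemma om_sqr m : om m.+1 ^+ 2 = om m.
Proof.
rewrite -expi_natmul /om expnS natrM; congr expi; field.
by rewrite pnatr_eq0 expn_eq0.
Qed.

Lemma om_half m : om m.+1 ^+ (2 ^ m) = -1.
Proof.
elim: m => [|m IH]; last by rewrite expnS exprM om_sqr.
rewrite expr1 /om expn1 mulrAC divff ?mul1r ?pnatr_eq0// /expi cospi sinpi.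
by apply/eqP; rewrite eq_complex /= oppr0 !eqxx.
Qed.

Lemma om_pow m : om m ^+ (2 ^ m) = 1.
Proof.
elim: m => [|m IH]; first by rewrite /om divr1 expi2pi.
by rewrite expnS exprM om_sqr.
Qed.

(** The order divides [2 ^ m]; a smaller one would divide [2 ^ m.-1], against [om_half]. *)
Lemma om_prim m : (2 ^ m).-primitive_root (om m).
Proof.
have npos : (0 < 2 ^ m)%N by rewrite expn_gt0.
have [k kP kd] := prim_order_exists npos (om_pow m).
case/(dvdn_pfactor _ _ (isT : prime 2)): kd => j jm kE; rewrite kE in kP.
move: jm; rewrite leq_eqVlt => /predU1P[jm|]; first by rewrite -[in (2 ^ m)%N]jm.
case: m {npos} kP => // m kP; rewrite ltnS => jm.
have : om m.+1 ^+ (2 ^ m) = 1.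
  by apply/eqP; rewrite -(prim_order_dvd kP) dvdn_exp2l.
rewrite om_half => /eqP; rewrite eq_sym -subr_eq0 opprK -[1 + 1]/(2%:R).
by rewrite pnatr_eq0.
Qed.

Lemma norm_om m : `|om m| = 1. Proof. exact: norm_expi. Qed.

Lemma om_neq0 m : om m != 0.
Proof. by rewrite -normr_eq0 norm_om oner_eq0. Qed.

(** The quantity tends to 4 pi. The bound 8 comes from [2 ^ m] chords of length [|om m.+1 - 1|]
    joining 1 to -1, whose distance is 2. *)
Lemma om_dist_ge m : 8 <= (2 ^ m.+2)%:R * `|om m.+2 - (om m.+2)^-1|.
Proof.
have E : om m.+2 - (om m.+2)^-1 = (om m.+2)^-1 * (om m.+1 - 1).
  by rewrite -(om_sqr m.+1); field; rewrite om_neq0.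
rewrite E normrM normfV norm_om invr1 mul1r.
have : `|om m.+1 ^+ (2 ^ m) - 1| <= (2 ^ m)%:R * `|om m.+1 - 1|.
  rewrite subrX1 normrM mulrC ler_wpM2r//.
  apply: le_trans (ler_norm_sum _ _ _) _.
  rewrite (eq_bigr (fun=> 1)) ?sumr_const ?card_ord// => i _.
  by rewrite normrX norm_om expr1n.
rewrite om_half (_ : -1 - 1 = - 2%:R) ?normrN ?normr_nat => [h|]; last by ring.
rewrite !expnS mulnA natrM -mulrA (_ : 8%:R = (2 * 2)%:R * 2%:R).
  by rewrite ler_pM2l.
by rewrite -natrM.
Qed.

Lemma small_pow (q c : C) : 0 <= q < 1 -> 0 < c ->
  exists N, forall n, (N <= n)%N -> q ^+ n < c.
Proof.
move=> /andP[q0 q1] c0.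
have qE : q = (complex.Re q)%:C by rewrite RRe_real// ger0_real.
have cE : c = (complex.Re c)%:C by rewrite RRe_real// gtr0_real.
move: q0 q1 c0; rewrite qE cE ler0c !ltcR => q0 q1 c0.
have := @cvg_expr R (complex.Re q); rewrite ger0_norm// => /(_ q1).
move=> /cvgrPdist_lt /(_ _ c0) [N _ NP]; exists N => n Nn.
have := NP n Nn; rewrite /= sub0r normrN ger0_norm ?exprn_ge0//.
by rewrite -rmorphXn ltcR.
Qed.

End Expi.

(** * Cauchy's formula as a limit of averages over roots of unity *)

Section Cauchy.
Variable R : realType.
Local Notation C := R[i].

Definition circle (r : R) (t : R) : C := r%:C * expi (2 * pi * t).

Lemma norm_real_complex (a : R) : `|a%:C| = `|a|%:C :> C.
Proof. by rewrite normc_def /= expr0n /= addr0 sqrtr_sqr. Qed.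

(** The difference quotient need not be known differentiable at [w]. Goursat is therefore applied to
    a homotopy avoiding [w], from the circle to a small loop around [w], along which the quotient is
    bounded by [|L| + 1] and the length is small. *)
Lemma circle_path_sum_cvg0 (g : C -> C) (w : C) (r : R) :
  (forall z, `|z| < 1 -> cdiff g z) -> `|w| < r%:C -> r < 1 ->
  forall c : C, 0 < c -> exists N, forall m, (N <= m)%N ->
  `|path_sum (fun x => (g x - g w) / (x - w)) (circle r) (2 ^ m) 0 1| < c.
Proof.
move=> dg wr r1 c c0.
have wE : `|w| = (complex.Re `|w|)%:C by rewrite RRe_real// ger0_real.
set rho := complex.Re `|w| in wE.
have rho0 : 0 <= rho by rewrite -ler0c -wE.
have rhor : rho < r by rewrite -ltcR -wE.
have r0 : 0 < r by apply: le_lt_trans rhor.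
have pi0 : 0 < pi :> R by exact: pi_gt0.
have w1 : `|w| < 1 by apply: lt_trans wr _; rewrite -[1]/(1%:C) ltcR.
set h := fun x : C => (g x - g w) / (x - w).
have [L LP] := differentiable_cE (dg _ w1).
have [d d0 dP] := LP 1 ltr01.
have dE : d = (complex.Re d)%:C by rewrite RRe_real// gtr0_real.
have cE : c = (complex.Re c)%:C by rewrite RRe_real// gtr0_real.
have LE : `|L| = (complex.Re `|L|)%:C by rewrite RRe_real// ger0_real.
set D := complex.Re d in dE; set c' := complex.Re c in cE.
set b := complex.Re `|L| in LE.
have D0 : 0 < D by rewrite -ltcR -dE.
have c'0 : 0 < c' by rewrite -ltcR -cE.
have b0 : 0 <= b by rewrite -ler0c -LE.
have b1 : 0 < b + 1 by apply: ltr_wpDl.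
pose x1 := c' / (16 * (b + 1) * pi).
have x10 : 0 < x1 by rewrite divr_gt0// !mulr_gt0.
(* [D / 4] puts the inner loop, at distance at most [del * 2] from [w], where the quotient is
   bounded by [b + 1]; [x1] makes its sum at most [c' / 4]; [1 / 2] keeps [1 - del] positive. *)
pose del := Num.min (1 / 2) (Num.min (D / 4) x1).
have del0 : 0 < del by rewrite /del !lt_min x10 !divr_gt0.
have del1 : del <= 1 / 2 by rewrite /del !ge_min lexx.
have delD : del <= D / 4 by rewrite /del !ge_min lexx !orbT.
have delx : del <= x1 by rewrite /del !ge_min lexx !orbT.
have hb z : `|z - w| < d -> `|h z| <= (b + 1)%:C.
  move=> zw; have [->|zwn] := eqVneq z w.
    by rewrite /h !subrr mul0r normr0 ler0c ltW.
  have zw0 : z - w != 0 by rewrite subr_eq0.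
  rewrite /h normrM normfV ler_pdivrMr ?normr_gt0// rmorphD /= mulrDl -LE -normrM mul1r.
  rewrite (_ : g z - g w = L * (z - w) + (g z - (g w + L * (z - w)))); last by ring.
  apply: le_trans (ler_normD _ _) _; rewrite lerD2l.
  by have := dP _ zw; rewrite mul1r.
pose zeta (s t : R) : C := w + (del + (1 - del) * s)%:C * (circle r t - w).
have nc t : `|circle r t| = r%:C.
  by rewrite normrM norm_expi mulr1 norm_real_complex ger0_norm// ltW.
have cw2 t : `|circle r t - w| <= 2%:R%:C.
  apply: le_trans (ler_normB _ _) _; rewrite nc wE -rmorphD lecR /=.
  by clear - rhor r1; lra.
have ccl t t' : `|circle r t' - circle r t| <= (4 * pi * `|t' - t|)%:C.
  rewrite /circle -mulrBr [`|_ * _|]normrM norm_real_complex [`|r|]ger0_norm ?(ltW r0)//.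
  apply: (@le_trans _ _ (r%:C * (2 * `|2 * pi * t' - 2 * pi * t|)%:C)).
    by apply: ler_wpM2l; [rewrite ler0c ltW|exact: expi_lip].
  rewrite -rmorphM lecR /= -mulrBr normrM ger0_norm ?mulr_ge0 ?(ltW pi0)//.
  have t0 := normr_ge0 (t' - t); set T := `|t' - t| in t0 *.
  have rT : r * (pi * T) <= 1 * (pi * T) by rewrite ler_wpM2r ?mulr_ge0 ?(ltW pi0)// ltW.
  by clear - rT t0; lra.
have tau s : 0 <= s <= 1 -> 0 < del + (1 - del) * s <= 1 by clear - del0 del1; nra.
have zeta_lt1 s t : 0 <= s <= 1 -> `|zeta s t| < 1.
  move=> /tau; rewrite /zeta; set T := del + _ => T01.
  rewrite (_ : w + T%:C * (circle r t - w) = (1 - T)%:C * w + T%:C * circle r t); last first.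
    by rewrite rmorphB /=; ring.
  apply: le_lt_trans (ler_normD _ _) _.
  move: (nc t); move: (circle r t) => q qr.
  rewrite !normrM qr wE !norm_real_complex.
  by rewrite -!rmorphM -rmorphD -[X in _ < X]/(1%:C) ltcR /= !ger0_norm;
    clear - T01 rho0 rhor r0 r1; clearbody T rho; nra.
have zetaNw s t : 0 <= s <= 1 -> zeta s t != w.
  move=> /tau T01; rewrite /zeta -subr_eq0 addrC addKr mulf_neq0//.
    by rewrite -[0]/(0%:C) (inj_eq (@complexI _)) gt_eqF//; clear - T01; lra.
  rewrite subr_eq0; apply: contraTneq wr => <-.
  by rewrite nc ltxx.
have [||||N NP] := @discrete_Goursat R h zeta (2 + 4 * pi) _ _ _ (c / 2).
- by rewrite addr_gt0// mulr_gt0.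
- by move=> s t s01 t01; apply: cdiff_quotient; [exact/dg/zeta_lt1|exact: zetaNw].
- move=> s t s' t' s01 t01 s01' t01'.
  rewrite (_ : zeta s' t' - zeta s t =
      ((1 - del) * (s' - s))%:C * (circle r t' - w) +
      (del + (1 - del) * s)%:C * (circle r t' - circle r t)); last first.
    by rewrite /zeta !rmorphD !rmorphM !rmorphB /=; ring.
  apply: le_trans (ler_normD _ _) _; rewrite !normrM !norm_real_complex.
  have n1 : `|(1 - del) * (s' - s)| <= `|s' - s|.
    by rewrite normrM ger0_norm; [rewrite ler_piMl//; clear - del0 del1; lra|clear - del1; lra].
  have n2 : `|del + (1 - del) * s| <= 1.
    by have T01 := tau _ s01; rewrite ger0_norm; clear - T01; lra.
  apply: le_trans (_ : (`|s' - s| * 2 + 1 * (4 * pi * `|t' - t|))%:C <= _).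
    rewrite rmorphD !rmorphM /=; apply: lerD; apply: ler_pM => //; rewrite ?ler0c ?lecR//.
    by have := ccl t t'; rewrite !rmorphM.
  rewrite lecR; have h1 := normr_ge0 (t' - t); have h2 := normr_ge0 (s' - s).
  by clear - h1 h2 pi0; nra.
- by rewrite divr_gt0.
exists N => m Nm; have {NP Nm} := NP m Nm.
rewrite /contour !add0r.
(* The circle closes up, so the sides t = 0 and t = 1 of the homotopy coincide and cancel. *)
have -> : zeta^~ 1 = zeta^~ 0.
  by apply/funext => s; rewrite /zeta /circle mulr1 expi2pi mulr0 expi0.
have -> : zeta 1 = circle r.
  by apply/funext => t; rewrite /zeta mulr1 [del + _]addrC subrK mul1r addrC subrK.
rewrite [X in X - _ - _]addrC addrK => lt1.
rewrite (_ : path_sum h (circle r) (2 ^ m) 0 1 =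
  (path_sum h (circle r) (2 ^ m) 0 1 - path_sum h (zeta 0) (2 ^ m) 0 1) +
  path_sum h (zeta 0) (2 ^ m) 0 1); last by rewrite subrK.
apply: le_lt_trans (ler_normD _ _) _.
rewrite (_ : c = c / 2 + c / 2); last by field.
apply: ltr_leD => //.
have z0 t : `|zeta 0 t - w| <= (del * 2)%:C.
  rewrite /zeta mulr0 addr0 addrC addKr normrM norm_real_complex [`|del|]ger0_norm ?(ltW del0)//.
  by rewrite [(del * 2)%:C]rmorphM /=; apply: ler_wpM2l; [rewrite ler0c ltW|exact: cw2].
apply: le_trans (@path_sum_le _ _ _ _ _ _ (b + 1)%:C (del * (4 * pi)) _ _ _ _ _) _.
- by rewrite expn_gt0.
- by [].
- by rewrite ler0c ltW.
- move=> t _; apply: hb; apply: le_lt_trans (z0 t) _.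
  by rewrite dE ltcR; clear - delD D0; lra.
- move=> t t' _ _; rewrite /zeta mulr0 addr0.
  rewrite (_ : _ - _ = del%:C * (circle r t' - circle r t)); last by ring.
  rewrite normrM norm_real_complex [`|del|]ger0_norm ?(ltW del0)//.
  by rewrite -mulrA rmorphM ler_pM2l ?ltcR.
have -> : c / 2 = (c' / 2)%:C by rewrite cE rmorphM fmorphV /= rmorph_nat.
rewrite mulr1 -rmorphM lecR /= [_ * (del * _)]mulrCA.
have le_x1 : del * ((b + 1) * (4 * pi)) <= x1 * ((b + 1) * (4 * pi)).
  by rewrite ler_wpM2r// mulr_ge0 ?mulr_ge0// ltW.
move: le_x1; have -> : x1 * ((b + 1) * (4 * pi)) = c' / 4.
  have pin : pi != 0 :> R by rewrite gt_eqF.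
  have bn : b + 1 != 0 by rewrite gt_eqF.
  by rewrite /x1; move: (@pi R) pin => p pin; field; rewrite pin bn.
by move=> le_x1; clear - le_x1 c'0; lra.
Qed.

End Cauchy.

Section Approx.
Variable R : realType.
Local Notation C := R[i].

Lemma real_le_eps (x y : C) : x \is Num.real -> y \is Num.real ->
  (forall e, 0 < e -> x <= y + e) -> x <= y.
Proof.
move=> xr yr xye; rewrite real_leNgt//; apply/negP => yx.
have := xye ((x - y) / 2); rewrite divr_gt0 ?subr_gt0// => /(_ isT) xle.
suff : y + (x - y) / 2 < x by move=> /(le_lt_trans xle); rewrite ltxx.
rewrite -subr_gt0 (_ : _ - _ = (x - y) / 2); last by field.
by rewrite divr_gt0// subr_gt0.
Qed.

Lemma exp2_ge n : (n <= 2 ^ n)%N.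
Proof. exact/ltnW/ltn_expl. Qed.

Lemma prim_rootV (F : fieldType) n (z : F) : n.-primitive_root z ->
  n.-primitive_root z^-1.
Proof.
move=> zp; have n0 := prim_order_gt0 zp.
have z0 : z != 0.
  apply/eqP => z0; have := prim_expr_order zp; rewrite z0 expr0n gtn_eqF//.
  by move/eqP; rewrite eq_sym oner_eq0.
have -> : z^-1 = z ^+ n.-1.
  by apply: (mulfI z0); rewrite divff// -exprS prednK// prim_expr_order.
by rewrite (prim_root_exp_coprime _ zp) coprimePn.
Qed.

Lemma sum_periodic (V : nmodType) (F : nat -> V) n : F n = F 0%N ->
  \sum_(k < n) F k.+1 = \sum_(k < n) F k.
Proof.
case: n => [|n] Fn; first by rewrite !big_ord0.
by rewrite big_ord_recr /= Fn big_ord_recl /= addrC.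
Qed.

Lemma circle_node (r : R) m (k : nat) :
  circle r (0 + 1 * k%:R / (2 ^ m)%:R) = r%:C * om R m ^+ k.
Proof. by rewrite /circle /om -expi_natmul add0r mul1r; congr (_ * expi _); ring. Qed.

(** Summation by parts around the cycle: each node is weighted by half the difference of its two
    neighbours, a fixed multiple of [om R m ^+ k]. *)
Lemma path_sum_circle (h : C -> C) (r : R) m :
  path_sum h (circle r) (2 ^ m) 0 1 =
  r%:C * (om R m - (om R m)^-1) / 2 *
  \sum_(k < 2 ^ m) h (r%:C * om R m ^+ k) * om R m ^+ k.
Proof.
pose o := om R m; pose H k := h (r%:C * o ^+ k).
have o0 : o != 0 by exact: om_neq0.
have HP : H (2 ^ m)%N * o ^+ (2 ^ m) = H 0%N * o ^+ 0.
  by rewrite /H !expr0 /o om_pow.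
transitivity (r%:C / 2 * ((o - 1) * (\sum_(k < 2 ^ m) H k * o ^+ k) +
    (1 - o^-1) * \sum_(k < 2 ^ m) H k.+1 * o ^+ k.+1)).
  rewrite !mulr_sumr -big_split mulr_sumr /=; apply: eq_bigr => k _.
  rewrite /edge !circle_node -/o -/(H k) -/(H k.+1) exprS; field.
  by rewrite o0.
rewrite (sum_periodic (F := fun k => H k * o ^+ k))// -/o.
by rewrite -mulrDl !mulrA; congr (_ * _); field; rewrite o0.
Qed.

(** A Riemann sum of Cauchy's integral: on the circle, d zeta / (2 pi i zeta) is normalised arc
    length. *)
Definition avg_Cauchy (g : C -> C) (r : R) (m : nat) (w : C) : C :=
  (2 ^ m)%:R^-1 * \sum_(k < 2 ^ m) g (r%:C * om R m ^+ k) / (1 - w / (r%:C * om R m ^+ k)).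

(** Subtract [g w] inside the average. The difference quotient gives a path sum tending to 0; the
    average of the Cauchy kernel alone is exactly [1 / (1 - t ^+ (2 ^ m))] with [t = w / r], which
    tends to 1. *)
Lemma Cauchy_formula (g : C -> C) (w : C) (r : R) :
  (forall z, `|z| < 1 -> cdiff g z) -> `|w| < r%:C -> r < 1 ->
  forall c : C, 0 < c -> exists N, forall m, (N <= m)%N ->
  `|avg_Cauchy g r m w - g w| < c.
Proof.
move=> dg wr r1 c c0.
have r0' : 0 < r%:C :> C by apply: le_lt_trans wr.
have r0 : r%:C != 0 :> C by rewrite gt_eqF.
set t := w / r%:C.
have t1 : 0 <= `|t| < 1.
  by rewrite normr_ge0 /t normrM normfV (gtr0_norm r0') ltr_pdivrMr ?mul1r.
have G0 : 0 < `|g w| + 1 :> C by rewrite ltr_wpDl.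
pose c1 := c / 2 / (`|g w| + 1).
have c10 : 0 < c1 by rewrite !divr_gt0.
pose e := Num.min (complex.Re c1 / 2) (1 / 2).
have c1E : c1 = (complex.Re c1)%:C by rewrite RRe_real// gtr0_real.
have Rc1 : 0 < complex.Re c1 by rewrite -ltcR -c1E.
have e0 : 0 < e by rewrite lt_min !divr_gt0.
have e1 : e <= 1 / 2 by rewrite ge_min lexx orbT.
have e2 : e <= complex.Re c1 / 2 by rewrite ge_min lexx.
have eC0 : 0 < e%:C :> C by rewrite ltcR.
have [N1 N1P] := small_pow t1 eC0.
(* By [om_dist_ge] the factor in front of the path sum is at most 1/4, so [2 * c] becomes [c / 2].
   That lemma needs an index of the form [m.+2], whence the [.+2] in the rank below. *)
have [N2 N2P] := circle_path_sum_cvg0 dg wr r1 (c := 2 * c) (mulr_gt0 (ltr0Sn _ _) c0).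
exists (N1 + N2).+2 => -[|[|m]]// /[!ltnS] Nm.
set M := m.+2.
have N1M : (N1 <= M)%N by rewrite (leq_trans (leq_addr N2 N1))// (leq_trans Nm)// leqW.
have N2M : (N2 <= M)%N by rewrite (leq_trans (leq_addl N1 N2))// (leq_trans Nm)// leqW.
set o := om R M; have o0 : o != 0 by exact: om_neq0.
have n0 : (2 ^ M)%:R != 0 :> C by rewrite pnatr_eq0 expn_eq0.
have no k : `|o ^+ k| = 1 by rewrite normrX norm_om expr1n.
pose X k := r%:C * o ^+ k.
have X0 k : X k != 0 by rewrite mulf_neq0// expf_neq0.
have Xw k : X k - w != 0.
  rewrite subr_eq0; apply: contraTneq wr => <-.
  by rewrite normrM no mulr1 gtr0_norm// ltxx.
have tn : `|t ^+ (2 ^ M)| < e%:C.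
  by rewrite normrX N1P// (leq_trans N1M)// exp2_ge.
have half : (1 / 2)%:C = 1 / 2 :> C by rewrite rmorphM fmorphV /= rmorph_nat.
have tn2 : 1 / 2 <= `|1 - t ^+ (2 ^ M)|.
  apply: le_trans (_ : 1 - `|t ^+ (2 ^ M)| <= _); last first.
    by have := lerB_dist 1 (t ^+ (2 ^ M)); rewrite normr1.
  rewrite lerBrDr -lerBrDl (le_trans (ltW tn))// (_ : 1 - 1 / 2 = 1 / 2); last by field.
  by rewrite -half lecR.
have tne : 1 - t ^+ (2 ^ M) != 0.
  by rewrite -normr_gt0 (lt_le_trans _ tn2)// divr_gt0.
have Q : (2 ^ M)%:R^-1 * (\sum_(k < 2 ^ M) 1 / (1 - w / X k)) = (1 - t ^+ (2 ^ M))^-1.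
  have /(prim_root_geom_avg (om := o^-1)) := n0.
  move=> /(_ (prim_rootV (om_prim R M)) t 0%N); rewrite expn_gt0 => h.
  rewrite -[RHS]mul1r -[X in X / _](expr0 t) -h//.
  - congr (_ * _); apply: eq_bigr => k _; rewrite mul0n expr0 invr1.
    by rewrite /X /t exprVn invfM mulrA.
  - by rewrite -subr_eq0 -opprB oppr_eq0.
  - move=> k; rewrite exprVn /t -mulrA -invfM -/(X k); apply: contraNneq (Xw k) => E.
    by rewrite (divr1_eq E) subrr.
have P : (2 ^ M)%:R^-1 * (\sum_(k < 2 ^ M) (g (X k) - g w) / (1 - w / X k)) =
    2 / ((2 ^ M)%:R * (o - o^-1)) *
    path_sum (fun x => (g x - g w) / (x - w)) (circle r) (2 ^ M) 0 1.
  have oo : o - o^-1 != 0.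
    have := om_dist_ge R m; rewrite -/M -/o; apply: contraTneq => ->.
    by rewrite normr0 mulr0 lt_geF.
  rewrite path_sum_circle -/o [RHS]mulrA (_ : _ * (r%:C * _ / 2) = (2 ^ M)%:R^-1 * r%:C).
    rewrite -[RHS]mulrA [X in _ = _ * X]mulr_sumr; congr (_ * _); apply: eq_bigr => k _.
    rewrite [RHS]mulrCA -/(X k).
    have -> : 1 - w / X k = (X k - w) / X k by rewrite mulrBl divff.
    by rewrite invf_div mulrA mulrAC.
  by move: (o - o^-1) oo => y y0; field; rewrite n0 y0.
have -> : avg_Cauchy g r M w - g w =
    (2 ^ M)%:R^-1 * (\sum_(k < 2 ^ M) (g (X k) - g w) / (1 - w / X k)) +
    g w * (t ^+ (2 ^ M) / (1 - t ^+ (2 ^ M))).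
  have -> : t ^+ (2 ^ M) / (1 - t ^+ (2 ^ M)) = (1 - t ^+ (2 ^ M))^-1 - 1.
    by move: tne => ?; field.
  rewrite mulrBr mulr1 -Q addrA; congr (_ - _); rewrite mulrCA -mulrDr; congr (_ * _).
  rewrite mulr_sumr -big_split /=; apply: eq_bigr => k _.
  by rewrite mulrA mulr1 -mulrDl subrK.
rewrite (_ : c = c / 2 + c / 2); last by field.
apply: le_lt_trans (ler_normD _ _) _; apply: ltr_leD.
  rewrite P normrM normrM normfV normr_nat normrM normr_nat.
  have D8 := om_dist_ge R m; rewrite -/M -/o in D8.
  have D0 : 0 < (2 ^ M)%:R * `|o - o^-1| by apply: lt_le_trans D8.
  rewrite mulrAC ltr_pdivrMr//.
  apply: lt_le_trans (_ : 2 * (2 * c) <= _).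
    by rewrite ltr_pM2l// N2P.
  apply: le_trans (_ : c / 2 * 8 <= _); last by rewrite ler_pM2l// divr_gt0.
  by rewrite (_ : c / 2 * 8 = 2 * (2 * c)) //; field.
rewrite normrM normrM normfV.
apply: le_trans (_ : `|g w| * c1 <= _); last first.
  rewrite /c1 mulrC mulrAC ler_pdivrMr//; apply: ler_wpM2l; first by rewrite divr_ge0// ltW.
  by rewrite lerDl.
apply: ler_wpM2l => //; rewrite ler_pdivrMr ?normr_gt0//.
apply: le_trans (ltW tn) _; apply: le_trans (_ : c1 * (1 / 2) <= _).
  by rewrite -half c1E -rmorphM lecR /= mul1r.
by apply: ler_wpM2l => //; exact: ltW.
Qed.

End Approx.

(** * Interpolation at roots of unity with a uniform error *)

Section Uniform.
Variable R : realType.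
Local Notation C := R[i].

Definition node (r : R) (m : nat) (k : 'I_(2 ^ m)) : C := r%:C * om R m ^+ k.

(** The Lagrange basis polynomial of the node [k]: at the nodes the powers are those of roots of
    unity, and their average is a Kronecker delta. *)
Definition weight (r : R) (m : nat) (k : 'I_(2 ^ m)) : {poly C} :=
  \poly_(j < 2 ^ m) ((2 ^ m)%:R^-1 * (r%:C * om R m ^+ k) ^- j).

Lemma weightE r m (k : 'I_(2 ^ m)) (w : C) :
  (weight r k).[w] = (2 ^ m)%:R^-1 * \sum_(j < 2 ^ m) (w / (r%:C * om R m ^+ k)) ^+ j.
Proof.
rewrite horner_poly mulr_sumr; apply: eq_bigr => j _.
by rewrite expr_div_n -mulrA [_^-1 * w ^+ j]mulrC.
Qed.

(** On a disk smaller than that of the nodes the Lebesgue constant is bounded independently of [m],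
    so interpolating in several variables successively costs only a constant factor. *)
Lemma weight_norm_sum (r r' : R) m (w : C) : 0 < r' -> 0 <= r < r' -> `|w| <= r%:C ->
  \sum_k `|(weight (m := m) r' k).[w]| <= (1 - (r / r')%:C)^-1.
Proof.
move=> r'0 /andP[r0 rr'] wr.
have q1 : r / r' < 1 by rewrite ltr_pdivrMr// mul1r.
have q0 : 0 <= r / r' by rewrite divr_ge0// ltW.
have Xn k : `|r'%:C * om R m ^+ k| = r'%:C.
  by rewrite normrM normrX norm_om expr1n mulr1 gtr0_norm// ltcR.
have q1C : 0 < 1 - (r / r')%:C :> C by rewrite subr_gt0 -[X in _ < X]/(1%:C) ltcR.
apply: le_trans (_ : \sum_(k < 2 ^ m) (2 ^ m)%:R^-1 * (1 - (r / r')%:C)^-1 <= _).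
  apply: ler_sum => k _; rewrite weightE normrM normfV normr_nat.
  apply: ler_wpM2l; first by rewrite invr_ge0.
  apply: le_trans (ler_norm_sum _ _ _) _.
  apply: le_trans (_ : \sum_(j < 2 ^ m) (r / r')%:C ^+ j <= _).
    apply: ler_sum => j _; rewrite normrX; apply: lerXn2r; [by rewrite nnegrE|by rewrite nnegrE ler0c|].
    rewrite normrM normfV Xn rmorphM fmorphV /=.
    by apply: ler_wpM2r => //; rewrite invr_ge0 ler0c ltW.
  rewrite -[X in X <= _](mulKf (lt0r_neq0 q1C)) -[X in _ <= X]mulr1.
  apply: ler_wpM2l; first by rewrite invr_ge0 ltW.
  rewrite -opprB mulNr -subrX1 opprB lerBlDr lerDl.
  by rewrite exprn_ge0// ler0c.
rewrite sumr_const card_ord -[X in X <= _]mulr_natl mulVKf// pnatr_eq0 expn_eq0//.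
Qed.

(** By linearity and Cauchy's formula on the larger circle [r2], only the functions
    [1 / (1 - w / X)] need be interpolated. Their error is explicit, [- t ^+ n * (1 - s ^+ n) / ((1
    - s * t) * (1 - t ^+ n))] with [t = r1 / X] and [s = w / r1], hence uniform in [w] and [g]. *)
Lemma interpolation_error (g : C -> C) (r1 r2 : R) (w : C) m :
  0 < r1 -> r1 < r2 -> r2 < 1 -> `|w| <= r1%:C ->
  (forall z, `|z| < 1 -> cdiff g z) -> (forall z, `|z| < 1 -> `|g z| <= 1) ->
  `|g w - \sum_k (weight (m := m) r1 k).[w] * g (node r1 k)| <=
   2 * (r1 / r2)%:C ^+ (2 ^ m) / (1 - (r1 / r2)%:C) ^+ 2.
Proof.
move=> r10 r12 r21 wr dg g1.
have r20 : 0 < r2 by apply: lt_trans r12.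
have rC1 : 0 < r1%:C :> C by rewrite ltcR.
have rC2 : 0 < r2%:C :> C by rewrite ltcR.
set q := (r1 / r2)%:C.
have q0 : 0 <= q by rewrite ler0c divr_ge0// ltW.
have q1 : q < 1 by rewrite -[X in _ < X]/(1%:C) ltcR ltr_pdivrMr// mul1r.
have q1C : 0 < 1 - q by rewrite subr_gt0.
have n0 : (2 ^ m)%:R != 0 :> C by rewrite pnatr_eq0 expn_eq0.
set n := (2 ^ m)%N; pose W k := (weight (m := m) r1 k).[w].
have node1 k : `|node (m := m) r1 k| = r1%:C.
  by rewrite normrM normrX norm_om expr1n mulr1 gtr0_norm.
have W1 k : `|W k| <= 1.
  rewrite /W weightE normrM normfV normr_nat ler_pdivrMl ?ltr0n ?expn_gt0// mulr1.
  apply: le_trans (ler_norm_sum _ _ _) _.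
  apply: le_trans (_ : \sum_(j < 2 ^ m) 1 <= _); last by rewrite sumr_const card_ord.
  apply: ler_sum => j _; rewrite normrX exprn_ile1// normrM normfV -/(node r1 k) node1.
  by rewrite ler_pdivrMr// mul1r.
have core m' : `|avg_Cauchy g r2 m' w -
    \sum_k W k * avg_Cauchy g r2 m' (node r1 k)| <= 2 * q ^+ n / (1 - q) ^+ 2.
  pose X l := r2%:C * om R m' ^+ l.
  have X0 l : X l != 0.
    by apply: mulf_neq0; [rewrite gt_eqF|rewrite expf_neq0// om_neq0].
  have Xn l : `|X l| = r2%:C by rewrite normrM normrX norm_om expr1n mulr1 gtr0_norm.
  have inner l : `|(1 - w / X l)^-1 - \sum_k W k / (1 - node r1 k / X l)| <=
      2 * q ^+ n / (1 - q) ^+ 2.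
    set t := r1%:C / X l; set s := w / r1%:C.
    have tq : `|t| = q by rewrite normrM normfV Xn gtr0_norm// /q rmorphM fmorphV.
    have s1 : `|s| <= 1.
      by rewrite normrM normfV (gtr0_norm rC1) ler_pdivrMr// mul1r.
    have st : w / X l = s * t by rewrite /s /t mulrA divfK ?gt_eqF.
    have tn1 : q ^+ n <= q by rewrite -[X in _ <= X]expr1 ler_wiXn2l ?expn_gt0 ?(ltW q1).
    have tnN : 1 - q <= `|1 - t ^+ n|.
      apply: le_trans (_ : 1 - `|t ^+ n| <= _); last first.
        by have := lerB_dist 1 (t ^+ n); rewrite normr1.
      by rewrite lerD2l lerN2 normrX tq.
    have stN : 1 - q <= `|1 - s * t|.
      apply: le_trans (_ : 1 - `|s * t| <= _); last first.
        by have := lerB_dist 1 (s * t); rewrite normr1.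
      by rewrite lerD2l lerN2 normrM tq ler_piMl.
    have tn0 : 1 - t ^+ n != 0 by rewrite -normr_gt0 (lt_le_trans q1C).
    have st0 : 1 - s * t != 0 by rewrite -normr_gt0 (lt_le_trans q1C).
    have E : \sum_k W k / (1 - node r1 k / X l) =
        (1 - (s * t) ^+ n) / ((1 - s * t) * (1 - t ^+ n)).
      transitivity (\sum_(j < n) s ^+ j *
          (n%:R^-1 * \sum_(k < n) om R m ^- (j * k) / (1 - t * om R m ^+ k))).
        under [RHS]eq_bigr do rewrite mulrCA mulr_sumr.
        rewrite -mulr_sumr exchange_big mulr_sumr; apply: eq_bigr => k _ /=.
        rewrite /W weightE -mulrA mulr_suml; congr (_ * _); apply: eq_bigr => j _.
        rewrite [X in _ = _ * (_ / (1 - X))](_ : _ = node r1 k / X l); last first.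
          by rewrite /t /node mulrAC.
        by rewrite mulrA invfM mulrA -/s exprMn exprVn exprM [in om R m ^+ j ^+ k]exprAC.
      transitivity (\sum_(j < n) (s * t) ^+ j / (1 - t ^+ n)).
        apply: eq_bigr => j _; rewrite (prim_root_geom_avg (om_prim R m))//.
        - by rewrite [(s * t) ^+ j]exprMn mulrA.
        - by rewrite -subr_eq0 -oppr_eq0 opprB.
        move=> k; apply: contraTneq q1 => E; rewrite -tq.
        have : `|t * om R m ^+ k| = 1 by rewrite E normr1.
        by rewrite normrM normrX norm_om expr1n mulr1 => ->; rewrite ltxx.
      rewrite -mulr_suml [in RHS]invfM [RHS]mulrA; congr (_ * _).
      by apply: (mulIf st0); rewrite divfK// -[RHS]opprB subrX1 -[RHS]mulNr opprB mulrC.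
    rewrite E st (_ : _ - _ = - (t ^+ n * (1 - s ^+ n)) / ((1 - s * t) * (1 - t ^+ n))); last first.
      by rewrite exprMn; move: tn0 st0 => h1 h2; field; rewrite h1 h2.
    rewrite normrM normrN normrM normfV normrM normrX tq.
    apply: ler_pM => //.
    + by apply: mulr_ge0 => //; exact: exprn_ge0.
    + by rewrite invr_ge0 mulr_ge0.
    + rewrite [X in X <= _]mulrC; apply: ler_wpM2r; first exact: exprn_ge0.
      apply: le_trans (ler_normB _ _) _; rewrite normr1 -[2]/(1 + 1) lerD2l.
      by rewrite normrX exprn_ile1.
    + rewrite lef_pV2 ?posrE ?exprn_gt0 ?mulr_gt0// ?normr_gt0//.
      by rewrite expr2; apply: ler_pM => //; exact: ltW.
  rewrite (_ : _ - _ = (2 ^ m')%:R^-1 * \sum_(l < 2 ^ m') g (X l) *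
     ((1 - w / X l)^-1 - \sum_k W k / (1 - node r1 k / X l))); last first.
    under eq_bigr do rewrite /avg_Cauchy mulrCA mulr_sumr.
    rewrite -mulr_sumr exchange_big -mulrBr -sumrB; congr (_ * _).
    apply: eq_bigr => l _ /=; rewrite mulrBr mulr_sumr; congr (_ - _).
    by apply: eq_bigr => k _; rewrite mulrCA.
  rewrite normrM normfV normr_nat ler_pdivrMl ?ltr0n ?expn_gt0//.
  apply: le_trans (ler_norm_sum _ _ _) _.
  apply: le_trans (_ : \sum_(l < 2 ^ m') 2 * q ^+ n / (1 - q) ^+ 2 <= _); last first.
    by rewrite sumr_const card_ord [X in _ <= X]mulr_natl.
  apply: ler_sum => l _; rewrite normrM -[X in _ <= X]mul1r.
  apply: ler_pM => //; apply: g1; rewrite Xn -[X in _ < X]/(1%:C) ltcR//.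
have bnd0 : 0 <= 2 * q ^+ n / (1 - q) ^+ 2.
  by rewrite divr_ge0 ?mulr_ge0 ?exprn_ge0// ltW.
apply: real_le_eps; [exact: normr_real|exact: ger0_real|move=> e e0].
(* Cauchy's formula is used at [w] and at the [n] nodes, whose weights have modulus at most 1:
   [n + 1] errors share [e]. *)
pose c := e / (n%:R + 1).
have N0 : 0 < n%:R + 1 :> C by rewrite ltr_wpDl.
have c0 : 0 < c by rewrite divr_gt0.
have lt12 : r1%:C < r2%:C :> C by rewrite ltcR.
have [N0' N0P] := Cauchy_formula dg (le_lt_trans wr lt12) r21 c0.
have nlt k : `|node (m := m) r1 k| < r2%:C by rewrite node1.
have /choice [N NP] k := Cauchy_formula dg (nlt k) r21 c0.
pose M := (N0' + \sum_k N k)%N.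
have MN k : (N k <= M)%N.
  by rewrite /M (bigD1 k)//= addnCA leq_addr.
rewrite (_ : g w - _ = (avg_Cauchy g r2 M w - \sum_k W k * avg_Cauchy g r2 M (node r1 k))
  + (\sum_k W k * (avg_Cauchy g r2 M (node r1 k) - g (node r1 k))
     - (avg_Cauchy g r2 M w - g w))); last first.
  under [X in _ = _ + (X - _)]eq_bigr do rewrite mulrBr.
  by rewrite sumrB; ring.
apply: le_trans (ler_normD _ _) _; apply: lerD; first exact: core.
apply: le_trans (ler_normB _ _) _.
rewrite (_ : e = n%:R * c + c); last by rewrite /c; field; rewrite gt_eqF.
apply: lerD; last by apply/ltW/N0P; rewrite leq_addr.
apply: le_trans (ler_norm_sum _ _ _) _.
apply: le_trans (_ : \sum_(k < n) c <= _); last by rewrite sumr_const card_ord mulr_natl.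
apply: ler_sum => k _; rewrite normrM -[X in _ <= X]mul1r; apply: ler_pM => //.
exact/ltW/NP.
Qed.

End Uniform.

(** * Finitely supported functions on the lattice Z^d *)

Section TrigPoly.
Variables (C : numClosedFieldType) (d : nat).

Definition Zd := {ffun 'I_d -> int}.
HB.instance Definition _ := GRing.Zmodule.on Zd.
HB.instance Definition _ := Countable.on Zd.

Implicit Types (a b : Zd) (x y : Zd -> C) (z : 'rV[C]_d) (P : seq (C * Zd)).

Definition pos (A : {set 'I_d}) a := [forall j, (j \in A) ==> (0 <= a j)].

Lemma posP (A : {set 'I_d}) a : reflect (forall j, j \in A -> 0 <= a j) (pos A a).
Proof. by apply: (iffP forallP) => h j; [exact/implyP|apply/implyP/h]. Qed.

Lemma pos_sub (A B : {set 'I_d}) a : A \subset B -> pos B a -> pos A a.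
Proof. by move=> /fintype.subsetP AB /posP h; apply/posP => j /AB /h. Qed.

Lemma posD (A : {set 'I_d}) a b : pos A a -> pos A b -> pos A (a + b).
Proof. by move=> /posP h /posP k; apply/posP => j jA; rewrite ffunE addr_ge0 ?h ?k. Qed.

Lemma pos0 (A : {set 'I_d}) : pos A 0.
Proof. by apply/posP => j _; rewrite ffunE. Qed.

Definition unit_vec (j : 'I_d) : Zd := [ffun i => (i == j)%:Z].

Lemma pos_unit_vec (A : {set 'I_d}) j : pos A (unit_vec j).
Proof. by apply/posP => i _; rewrite ffunE. Qed.

Definition mon z a : C := \prod_j z ord0 j ^ a j.

Lemma mon0 z : mon z 0 = 1.
Proof. by rewrite /mon big1// => j _; rewrite ffunE. Qed.

(** Since the inverse of 0 is 0, additivity fails at zero coordinates for exponents of opposite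
    signs. This version serves in the polydisk, [monD_unit] on the torus. *)
Lemma monD z a b : pos [set: 'I_d] a -> pos [set: 'I_d] b -> mon z (a + b) = mon z a * mon z b.
Proof.
move=> /posP ha /posP hb; rewrite /mon -big_split; apply: eq_bigr => j _ /=.
rewrite ffunE; have := hb j (finset.in_setT _); have := ha j (finset.in_setT _).
by case: (a j) => // m _; case: (b j) => // n _; rewrite -PoszD -!exprnP exprD.
Qed.

Lemma monD_unit z a b : (forall j, z ord0 j != 0) -> mon z (a + b) = mon z a * mon z b.
Proof.
move=> z0; rewrite /mon -big_split; apply: eq_bigr => j _ /=.
by rewrite ffunE expfzDr.
Qed.

Lemma mon_unit_vec z j : mon z (unit_vec j) = z ord0 j.
Proof.
rewrite /mon (bigD1 j)//= ffunE eqxx expr1z big1 ?mulr1// => i ij.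
by rewrite ffunE (negbTE ij).
Qed.

Definition finsup x := exists s : seq Zd, forall a, a \notin s -> x a = 0.
Definition fsum x : C := \sum_(a \in [set: Zd]) x a.

Lemma fsumE (s : seq Zd) x : uniq s -> (forall a, a \notin s -> x a = 0) ->
  fsum x = \sum_(a <- s) x a.
Proof.
move=> us xs; rewrite /fsum (@fsbigE _ _ _ _ _ s x us)//; last by move=> a _; exact: xs.
by apply: eq_bigl => a; rewrite in_setT.
Qed.

Lemma finsup_seq x : finsup x ->
  exists2 s : seq Zd, uniq s & forall a, a \notin s -> x a = 0.
Proof.
move=> [s sP]; exists (undup s); rewrite ?undup_uniq// => a.
by rewrite mem_undup; exact: sP.
Qed.

Lemma finsup_seq2 x y : finsup x -> finsup y -> exists2 s : seq Zd, uniq s &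
  forall a, a \notin s -> x a = 0 /\ y a = 0.
Proof.
move=> [s sP] [t tP]; exists (undup (s ++ t)); rewrite ?undup_uniq// => a.
by rewrite mem_undup mem_cat negb_or => /andP[/sP ? /tP ?].
Qed.

Lemma eq_fsum x y : x =1 y -> fsum x = fsum y.
Proof. by move=> xy; congr fsum; exact/funext. Qed.

Lemma finsup_sub x y : finsup x -> (forall a, x a = 0 -> y a = 0) -> finsup y.
Proof. by move=> [s sP] xy; exists s => a /sP /xy. Qed.

Lemma finsupD x y : finsup x -> finsup y -> finsup (fun a => x a + y a).
Proof.
move=> fx fy; have [s us sP] := finsup_seq2 fx fy.
by exists s => a /sP[-> ->]; rewrite addr0.
Qed.

Lemma finsup0 : finsup (fun=> 0). Proof. by exists [::]. Qed.

Lemma finsup_sum (I : Type) (r : seq I) (F : I -> Zd -> C) :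
  (forall i, finsup (F i)) -> finsup (fun a => \sum_(i <- r) F i a).
Proof.
move=> fF; elim: r => [|i r IH].
  by apply: finsup_sub finsup0 _ => a _; rewrite big_nil.
by apply: finsup_sub (finsupD (fF i) IH) _ => a /=; rewrite big_cons.
Qed.

Lemma finsup_shift x b : finsup x -> finsup (fun a => x (a + b)).
Proof.
move=> [s sP]; exists [seq a - b | a <- s] => a; apply: contraNeq => xa.
apply/mapP; exists (a + b); last by rewrite addrK.
by apply: contraNT xa => /sP ->.
Qed.

Lemma finsupMl x y : finsup x -> finsup (fun a => y a * x a).
Proof. by move=> fx; apply: finsup_sub fx _ => a ->; rewrite mulr0. Qed.

Lemma finsup_conj x : finsup x -> finsup (fun a => (x a)^*).
Proof. by move=> fx; apply: finsup_sub fx _ => a ->; rewrite conjC0. Qed.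

Lemma finsup_normsq x : finsup x -> finsup (fun a => `|x a| ^+ 2).
Proof. by move=> fx; apply: finsup_sub fx _ => a ->; rewrite normr0 expr0n. Qed.

Lemma finsup_if (p : pred Zd) x : finsup x -> finsup (fun a => if p a then x a else 0).
Proof. by move=> fx; apply: finsup_sub fx _ => a ->; case: ifP. Qed.

Lemma fsumD x y : finsup x -> finsup y ->
  fsum (fun a => x a + y a) = fsum x + fsum y.
Proof.
move=> fx fy; have [s us sP] := finsup_seq2 fx fy.
rewrite (fsumE us) => [|a /sP[-> ->]]; last exact: addr0.
by rewrite big_split; congr (_ + _); rewrite (fsumE us)// => a /sP[].
Qed.

Lemma fsum0 : fsum (fun=> 0) = 0.
Proof. by rewrite (@fsumE [::])// big_nil. Qed.

Lemma fsumZ c x : finsup x -> fsum (fun a => c * x a) = c * fsum x.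
Proof.
move=> /finsup_seq[s us sP]; rewrite !(fsumE us)//; first by rewrite mulr_sumr.
by move=> a /sP ->; rewrite mulr0.
Qed.

Lemma fsumN x : finsup x -> fsum (fun a => - x a) = - fsum x.
Proof.
by move=> fx; rewrite -mulN1r -fsumZ//; apply: eq_fsum => a; rewrite mulN1r.
Qed.

Lemma fsum_sum (I : Type) (r : seq I) (F : I -> Zd -> C) :
  (forall i, finsup (F i)) ->
  fsum (fun a => \sum_(i <- r) F i a) = \sum_(i <- r) fsum (F i).
Proof.
move=> fF; elim: r => [|i r IH].
  by rewrite big_nil -[RHS]fsum0; apply: eq_fsum => a; rewrite big_nil.
rewrite big_cons -IH -fsumD//; last exact: finsup_sum.
by apply: eq_fsum => a; rewrite big_cons.
Qed.

Lemma fsum_shift x b : fsum (fun a => x (a + b)) = fsum x.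
Proof.
rewrite /fsum [RHS](reindex_fsbigT (fun a : Zd => a + b))//.
by exists (fun a => a - b) => a; rewrite ?addrK ?subrK.
Qed.

Lemma fsum_conj x : finsup x -> (fsum x)^* = fsum (fun a => (x a)^*).
Proof.
move=> /finsup_seq[s us sP]; rewrite !(fsumE us)//; first by rewrite rmorph_sum.
by move=> a /sP ->; rewrite conjC0.
Qed.

Lemma fsum_ge0 x : finsup x -> (forall a, 0 <= x a) -> 0 <= fsum x.
Proof. by move=> /finsup_seq[s us sP] x0; rewrite (fsumE us)// sumr_ge0. Qed.

Lemma fsum_delta (c : C) b : fsum (fun a => if a == b then c else 0) = c.
Proof.
rewrite (@fsumE [:: b])// => [|a]; first by rewrite big_seq1 eqxx.
by rewrite inE => /negbTE ->.
Qed.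

Definition normsq x : C := fsum (fun a => `|x a| ^+ 2).

Lemma normsq_ge0 x : finsup x -> 0 <= normsq x.
Proof. by move=> fx; apply: fsum_ge0 => [|a]; [exact: finsup_normsq|exact: exprn_ge0]. Qed.

Lemma normsq_shift x b : normsq (fun a => x (a + b)) = normsq x.
Proof. exact: (fsum_shift (fun a => `|x a| ^+ 2)). Qed.

Definition poly_eval P z : C := \sum_(p <- P) p.1 * mon z p.2.
(** Multiplication by the polynomial [P], seen on Fourier coefficients. *)
Definition conv P x a : C := \sum_(p <- P) p.1 * x (a - p.2).
Definition nonneg P := all (fun p : C * Zd => pos [set: 'I_d] p.2) P.

Lemma finsup_conv P x : finsup x -> finsup (conv P x).
Proof.
move=> fx; apply: (finsup_sum P (F := fun p a => p.1 * x (a - p.2))) => p.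
by apply: finsupMl; exact: (finsup_shift (- p.2) fx).
Qed.

Lemma conv_shift P x b a : conv P (fun a => x (a + b)) a = conv P x (a + b).
Proof. by apply: eq_bigr => p _; rewrite addrAC. Qed.

Lemma convD P x y a : conv P (fun a => x a + y a) a = conv P x a + conv P y a.
Proof. by rewrite -big_split; apply: eq_bigr => p _; rewrite mulrDr. Qed.

Lemma convZ P c x a : conv P (fun a => c * x a) a = c * conv P x a.
Proof. by rewrite mulr_sumr; apply: eq_bigr => p _; rewrite mulrCA. Qed.

Lemma conv_sum P (I : Type) (r : seq I) (F : I -> Zd -> C) a :
  conv P (fun a => \sum_(i <- r) F i a) a = \sum_(i <- r) conv P (F i) a.
Proof.
by rewrite [RHS]exchange_big; apply: eq_bigr => p _; rewrite mulr_sumr.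
Qed.

Definition supported (A : {set 'I_d}) x := forall a, ~~ pos A a -> x a = 0.

Lemma supported_conv A P x : nonneg P -> supported A x -> supported A (conv P x).
Proof.
move=> /allP Pp xA a aA; rewrite /conv big_seq big1// => p pP.
rewrite xA ?mulr0//; apply: contra aA => h; rewrite -(subrK p.2 a); apply: posD => //.
by apply: (pos_sub (finset.subsetT A)); exact: Pp.
Qed.

Lemma poly_eval_conv P x z : finsup x -> (forall j, z ord0 j != 0) ->
  fsum (fun a => conv P x a * mon z a) = poly_eval P z * fsum (fun a => x a * mon z a).
Proof.
move=> fx z0.
have fxm : finsup (fun a => x a * mon z a).
  by apply: finsup_sub fx _ => a ->; rewrite mul0r.
have fp p : finsup (fun a => p.1 * x (a - p.2) * mon z a).
  apply: finsup_sub (finsup_shift (- p.2) fx) _ => a ->.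
  by rewrite mulr0 mul0r.
under eq_fsum do rewrite /conv mulr_suml.
rewrite fsum_sum// mulr_suml; apply: eq_bigr => p _.
rewrite -(fsum_shift _ p.2) -fsumZ//.
by apply: eq_fsum => a; rewrite addrK monD_unit//; ring.
Qed.

End TrigPoly.

(** * Parseval's identity on finite grids of the torus *)

Section Parseval.
Variables (R : realType) (d : nat).
Local Notation C := R[i].
Local Notation Zd := (Zd d).
Implicit Types (a b : Zd) (x : Zd -> C) (P : seq (C * Zd)).

Definition grid (m : nat) (k : {ffun 'I_d -> 'I_(2 ^ m)}) : 'rV[C]_d :=
  \row_j om R m ^+ k j.

Lemma grid_norm m k (j : 'I_d) : `|@grid m k ord0 j| = 1.
Proof. by rewrite mxE normrX norm_om expr1n. Qed.

Lemma mon_conj (z : 'rV[C]_d) a : (forall j, `|z ord0 j| = 1) ->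
  (mon z a)^* = mon z (- a).
Proof.
move=> z1; rewrite /mon rmorph_prod /=; apply: eq_bigr => j _.
have zV : (z ord0 j)^* = (z ord0 j)^-1 by rewrite invC_norm z1 expr1n invr1 mul1r.
by rewrite ffunE -exprz_inv -zV; case: (a j) => n; rewrite ?rmorphXn// fmorphV rmorphXn.
Qed.

Lemma grid_orthogonal m (c : Zd) (j : 'I_d) : ~~ (2 ^ m %| `|c j|)%N ->
  \sum_k mon (@grid m k) c = 0.
Proof.
move=> jc; rewrite /mon.
transitivity (\sum_(k : {ffun 'I_d -> 'I_(2 ^ m)}) \prod_i (om R m ^ c i) ^+ k i).
  apply: eq_bigr => k _; apply: eq_bigr => i _; rewrite mxE.
  by rewrite exprnP exprz_exp mulrC -exprz_exp.
rewrite -(bigA_distr_bigA (fun i (k : 'I_(2 ^ m)) => (om R m ^ c i) ^+ k)).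
rewrite (bigD1 j)//= [X in X * _](_ : _ = 0) ?mul0r//.
have u1 : om R m ^ c j - 1 != 0.
  rewrite subr_eq0; move: jc; case: (c j) => n.
    by rewrite absz_nat (prim_order_dvd (om_prim R m)).
  by rewrite NegzE abszN absz_nat -exprnN invr_eq1 (prim_order_dvd (om_prim R m)).
apply: (mulfI u1); rewrite mulr0 -subrX1 exprnP exprz_exp mulrC -exprz_exp.
by rewrite -exprnP om_pow exp1rz subrr.
Qed.

Lemma separated_mod (s : seq Zd) : exists M, forall m, (M <= m)%N ->
  forall a b, a \in s -> b \in s -> a != b ->
  exists j, ~~ (2 ^ m %| absz ((a - b)%R j))%N.
Proof.
exists (\sum_(a <- s) \sum_(b <- s) \sum_j absz ((a - b)%R j))%N => m Mm a b sa sb ab.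
have [j abj] : exists j, (a - b) j != 0.
  apply/existsP; apply: contraNT ab => /existsPn h; apply/eqP/ffunP => j.
  by apply/eqP; have := h j; rewrite negbK !ffunE subr_eq0.
exists j; apply/negP => /dvdn_leq; rewrite absz_gt0 abj => /(_ isT).
apply/negP; rewrite -ltnNge; apply: leq_ltn_trans (ltn_expl m (ltnSn 1)).
apply: leq_trans Mm; rewrite (big_rem _ sa)/= (big_rem _ sb)/= (bigD1 j)//=.
by rewrite -!addnA leq_addr.
Qed.

(** The identity is exact as soon as the finitely many frequencies of [x] are distinct modulo
    [2 ^ m], for then their characters are orthogonal on the grid. *)
Lemma Parseval x : finsup x -> exists M, forall m, (M <= m)%N ->
  normsq x = ((2 ^ m) ^ d)%:R^-1 *
    \sum_k `|fsum (fun a => x a * mon (@grid m k) a)| ^+ 2.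
Proof.
move=> /finsup_seq[s us sP]; have [M MP] := separated_mod s.
exists M => m /MP sep.
have n0 : ((2 ^ m) ^ d)%:R != 0 :> C by rewrite pnatr_eq0 !expn_eq0.
have E (k : {ffun 'I_d -> 'I_(2 ^ m)}) : `|fsum (fun a => x a * mon (grid k) a)| ^+ 2 =
   \sum_(a <- s) \sum_(b <- s) x a * (x b)^* * mon (grid k) (a - b).
  rewrite (fsumE us) => [|a /sP ->]; last exact: mul0r.
  rewrite normCK rmorph_sum mulr_suml; apply: eq_bigr => a _.
  rewrite mulr_sumr; apply: eq_bigr => b _.
  rewrite monD_unit; last by move=> j; rewrite -normr_gt0 grid_norm.
  by rewrite rmorphM /= mon_conj; [ring|exact: grid_norm].
rewrite (eq_bigr _ (fun k _ => E k)) exchange_big /= mulr_sumr.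
rewrite /normsq (fsumE us) => [|a /sP ->]; last by rewrite normr0 expr0n.
apply: eq_big_seq => a sa; rewrite exchange_big /=.
rewrite (big_rem a sa) /= [X in _ * (_ + X)]big_seq [X in _ * (_ + X)]big1 => [|b].
  rewrite addr0 subrr; under eq_bigr do rewrite mon0 mulr1.
  rewrite sumr_const card_ffun !card_ord -normCK -[X in _ = _ * X]mulr_natl mulKf//.
rewrite (mem_rem_uniq _ us) inE => /andP[ba sb].
have [|j jP] := sep a b sa sb; first by rewrite eq_sym.
by rewrite -mulr_sumr (grid_orthogonal jP) mulr0.
Qed.

(** On a grid fine enough for both [x] and [conv P x], convolution is pointwise multiplication by
    values of modulus at most [rho]. *)
Lemma conv_contraction P (rho : C) x : 0 <= rho ->
  (forall z : 'rV[C]_d, (forall j, `|z ord0 j| = 1) -> `|poly_eval P z| <= rho) ->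
  finsup x -> normsq (conv P x) <= rho ^+ 2 * normsq x.
Proof.
move=> rho0 Prho fx; have [M1 M1P] := Parseval fx.
have [M2 M2P] := Parseval (finsup_conv P fx).
rewrite (M1P (M1 + M2)%N) ?leq_addr// (M2P (M1 + M2)%N) ?leq_addl// mulrCA.
apply: ler_wpM2l; first by rewrite invr_ge0.
rewrite mulr_sumr; apply: ler_sum => k _.
rewrite poly_eval_conv//; last by move=> j; rewrite -normr_gt0 grid_norm.
rewrite normrM exprMn; apply: ler_wpM2r; first exact: exprn_ge0.
by apply: lerXn2r; rewrite ?nnegrE//; apply: Prho => j; exact: grid_norm.
Qed.

End Parseval.

(** * Polynomial approximation on the polydisk *)

Section PolyFun.
Variables (C : numClosedFieldType) (d : nat).
Local Notation Zd := (Zd d).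
Implicit Types (F G : 'rV[C]_d -> C).

Definition polyfun F := exists2 P : seq (C * Zd), nonneg P & F =1 poly_eval P.

Lemma eq_polyfun F G : F =1 G -> polyfun F -> polyfun G.
Proof. by move=> FG [P Pp FP]; exists P => // z; rewrite -FG FP. Qed.

Lemma polyfun_cst c : polyfun (fun=> c).
Proof.
exists [:: (c, 0)]; first by rewrite /nonneg /= pos0.
by move=> z; rewrite /poly_eval big_seq1 mon0 mulr1.
Qed.

Lemma polyfunD F G : polyfun F -> polyfun G -> polyfun (fun z => F z + G z).
Proof.
move=> [P Pp FP] [Q Qp GQ]; exists (P ++ Q); first by rewrite /nonneg all_cat; apply/andP.
by move=> z; rewrite FP GQ /poly_eval big_cat.
Qed.

Lemma polyfunZ c F : polyfun F -> polyfun (fun z => c * F z).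
Proof.
move=> [P Pp FP]; exists [seq (c * p.1, p.2) | p <- P].
  by rewrite /nonneg all_map.
by move=> z; rewrite FP /poly_eval big_map mulr_sumr; apply: eq_bigr => p _; rewrite mulrA.
Qed.

Lemma polyfun_mulX j F : polyfun F -> polyfun (fun z => z ord0 j * F z).
Proof.
move=> [P Pp FP]; exists [seq (p.1, unit_vec j + p.2) | p <- P].
  by rewrite /nonneg all_map; apply: sub_all Pp => p pp /=; rewrite posD ?pos_unit_vec.
move=> z; rewrite FP /poly_eval big_map mulr_sumr; apply: eq_big_seq => p pP /=.
rewrite monD ?mon_unit_vec ?pos_unit_vec//; first by rewrite mulrCA.
by have /allP := Pp; apply.
Qed.

Lemma polyfun_sum (I : Type) (r : seq I) (F : I -> 'rV[C]_d -> C) :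
  (forall i, polyfun (F i)) -> polyfun (fun z => \sum_(i <- r) F i z).
Proof.
move=> fF; elim: r => [|i r IH].
  by apply: eq_polyfun (polyfun_cst 0) => z; rewrite big_nil.
by apply: eq_polyfun (polyfunD (fF i) IH) => z; rewrite big_cons.
Qed.

Lemma polyfun_horner j (p : {poly C}) F : polyfun F ->
  polyfun (fun z => p.[z ord0 j] * F z).
Proof.
move=> pF; elim/poly_ind: p => [|p c IH].
  by apply: eq_polyfun (polyfun_cst 0) => z; rewrite horner0 mul0r.
apply: eq_polyfun (polyfunD (polyfun_mulX j IH) (polyfunZ c pF)) => z.
by rewrite hornerMXaddC; ring.
Qed.

Lemma polyfun_dilate c F : polyfun F -> polyfun (fun z => F (c *: z)).
Proof.
move=> [P Pp FP]; exists [seq (p.1 * mon (const_mx c) p.2, p.2) | p <- P].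
  by rewrite /nonneg all_map.
move=> z; rewrite FP /poly_eval big_map; apply: eq_big_seq => p pP /=.
rewrite -mulrA /mon -big_split; congr (_ * _); apply: eq_bigr => j _ /=.
rewrite !mxE; have /allP /(_ _ pP) /posP /(_ j (finset.in_setT _)) := Pp.
by case: (p.2 j) => // n _; rewrite -!exprnP exprMn.
Qed.

End PolyFun.

Section Multi.
Variables (R : realType) (d : nat).
Local Notation C := R[i].
Implicit Types (F : 'rV[C]_d -> C) (z : 'rV[C]_d) (s : seq 'I_d).

Definition upd z (j : 'I_d) (t : C) : 'rV[C]_d :=
  \row_i (if i == j then t else z ord0 i).

Lemma upd_id z j : upd z j (z ord0 j) = z.
Proof. by apply/rowP => i; rewrite !mxE; case: eqP => [->|]. Qed.

Lemma differentiable_upd (K : numFieldType) (v w : 'rV[K]_d) (t : K) :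
  differentiable (fun t : K => t *: v + w) t.
Proof. by apply: differentiableD => //; exact: differentiable_cst. Qed.

Lemma slice_cdiff (f : 'rV[C]_d -> C) z j t : holomorphic_on (@polydisk C d) f ->
  polydisk (upd z j t) -> cdiff (fun t => f (upd z j t)) t.
Proof.
move=> hf pz.
have E u : upd z j u = u *: delta_mx ord0 j + upd z j 0.
  by apply/rowP => i; rewrite !mxE eqxx /=; case: eqP => _; rewrite ?mulr1 ?mulr0 ?addr0 ?add0r.
rewrite (_ : (fun t => _) = f \o (fun u : C => u *: delta_mx ord0 j + upd z j 0)); last first.
  by apply/funext => u /=; rewrite E.
by apply: differentiable_comp; [exact: differentiable_upd|rewrite -E; exact: hf].
Qed.

Definition interp (r : R) m (j : 'I_d) F z : C :=
  \sum_(k < 2 ^ m) (weight r k).[z ord0 j] * F (upd z j (node r k)).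

(** A coordinate already replaced by a node is frozen in [y]; those in [s] are still variables. The
    induction on [s] moves one coordinate at a time from [z] to [y]. *)
Definition mix s (y z : 'rV[C]_d) : 'rV[C]_d :=
  \row_i (if i \in s then z ord0 i else y ord0 i).

Lemma foldr_interp_polyfun r m F s (y : 'rV[C]_d) : uniq s ->
  polyfun (fun z => foldr (interp r m) F s (mix s y z)).
Proof.
elim: s y => [|j s IH] y /=.
  by move=> _; apply: eq_polyfun (polyfun_cst _ (F y)) => z; congr F; apply/rowP => i; rewrite mxE.
move=> /andP[js us].
have Ej k z : upd (mix (j :: s) y z) j (node r k) = mix s (upd y j (node (m := m) r k)) z.
  apply/rowP => i; rewrite !mxE inE; case: eqP => [->|_] /=; last by [].
  by rewrite (negbTE js).
apply: (@eq_polyfun _ _ (fun z => \sum_(k < 2 ^ m) (weight r k).[z ord0 j] *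
    foldr (interp r m) F s (mix s (upd y j (node r k)) z))) => [z|].
  by rewrite /interp; apply: eq_bigr => k _; rewrite Ej mxE inE eqxx.
by apply: polyfun_sum => k; apply: polyfun_horner; exact: IH.
Qed.

(** The first variable costs its one-variable error; the error in the others is summed against
    weights of total modulus at most [(1 - r / r1)^-1], whence the geometric sum. The first
    coordinate then lies at radius [r1], which is harmless because [s] has no repetition. *)
Lemma foldr_interp_error (f : 'rV[C]_d -> C) (r r1 r2 : R) m s z :
  holomorphic_on (@polydisk C d) f -> (forall z, polydisk z -> `|f z| <= 1) ->
  0 < r -> r < r1 -> r1 < r2 -> r2 < 1 -> uniq s -> polydisk z ->
  (forall j, j \in s -> `|z ord0 j| <= r%:C) ->
  `|f z - foldr (interp r1 m) f s z| <=
   2 * (r1 / r2)%:C ^+ (2 ^ m) / (1 - (r1 / r2)%:C) ^+ 2 *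
   \sum_(i < size s) (1 - (r / r1)%:C)^-1 ^+ i.
Proof.
move=> hf f1 r0 rr1 r12 r21; set err := _ / _ ^+ 2; set B := (_^-1 : C).
have r10 : 0 < r1 by apply: lt_trans rr1.
have r20 : 0 < r2 by apply: lt_trans r12.
have B0 : 0 <= B.
  by rewrite invr_ge0 subr_ge0 -[X in _ <= X]/(1%:C) lecR ler_pdivrMr// mul1r ltW.
have r11 : r1%:C < 1 :> C by rewrite -[X in _ < X]/(1%:C) ltcR (lt_trans r12).
have node1 k : `|node (m := m) r1 k| < 1.
  by rewrite normrM normrX norm_om expr1n mulr1 norm_real_complex gtr0_norm.
elim: s z => [|j s IH] z /=; first by rewrite big_ord0 mulr0 subrr normr0.
move=> /andP[js us] zD zr.
have updD t : `|t| < 1 -> polydisk (upd z j t).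
  by move=> t1 i; rewrite mxE; case: eqP => // _; exact: zD.
have zj : `|z ord0 j| <= r%:C by apply: zr; rewrite inE eqxx.
rewrite (_ : f z - _ = (f z - interp r1 m j f z) + \sum_(k < 2 ^ m)
   (weight r1 k).[z ord0 j] * (f (upd z j (node r1 k)) -
     foldr (interp r1 m) f s (upd z j (node r1 k)))); last first.
  under [X in _ = _ + X]eq_bigr do rewrite mulrBr.
  by rewrite sumrB addrA subrK.
apply: le_trans (ler_normD _ _) _.
rewrite big_ord_recl expr0 mulrDr mulr1; apply: lerD.
  have := @interpolation_error R (fun t => f (upd z j t)) r1 r2 (z ord0 j) m r10 r12 r21.
  rewrite /= upd_id; apply.
  - by apply: le_trans zj _; rewrite lecR ltW.
  - by move=> t t1; apply: slice_cdiff => //; exact: updD.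
  - by move=> t /updD /f1.
under [X in _ * X]eq_bigr do rewrite lift0 exprS.
rewrite -mulr_sumr mulrCA.
apply: le_trans (ler_norm_sum _ _ _) _.
have S0 : 0 <= err * \sum_(i < size s) B ^+ i.
  apply: mulr_ge0; last by apply: sumr_ge0 => i _; exact: exprn_ge0.
  have q0 : 0 <= (r1 / r2)%:C :> C by rewrite ler0c divr_ge0// ltW.
  have q1 : (r1 / r2)%:C <= 1 :> C.
    by rewrite -[X in _ <= X]/(1%:C) lecR ler_pdivrMr// mul1r ltW.
  by rewrite divr_ge0 ?mulr_ge0 ?exprn_ge0// subr_ge0.
apply: le_trans (_ : \sum_(k < 2 ^ m) `|(weight r1 k).[z ord0 j]| *
   (err * \sum_(i < size s) B ^+ i) <= _).
  apply: ler_sum => k _; rewrite normrM; apply: ler_wpM2l => //.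
  apply: IH => //; first exact: updD.
  move=> i si; rewrite mxE; case: eqP => [ij|_]; last by apply: zr; rewrite inE si orbT.
  by rewrite -ij si in js.
rewrite -mulr_suml; apply: ler_wpM2r => //.
by apply: weight_norm_sum; rewrite ?(ltW r0).
Qed.

Lemma polydisk_poly_approx (f : 'rV[C]_d -> C) (r : R) (e : C) :
  holomorphic_on (@polydisk C d) f -> (forall z, polydisk z -> `|f z| <= 1) ->
  0 < r -> r < 1 -> 0 < e ->
  exists2 F, polyfun F & forall z, (forall j, `|z ord0 j| <= r%:C) -> `|f z - F z| <= e.
Proof.
move=> hf f1 r0 r1 e0.
(* Approximation holds at radius [r], the nodes lie at radius [r'], and Cauchy's formula is used at
   radius [r'']. *)
pose r' := (r + 1) / 2; pose r'' := (r' + 1) / 2.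
have [h1 h2 h3 h4 h5] : [/\ r < r', r' < r'', r'' < 1, 0 < r' & 0 < r''].
  by rewrite /r'' /r'; split; lra.
pose B : C := (1 - (r / r')%:C)^-1; pose q : C := (r' / r'')%:C.
pose S := \sum_(i < d) B ^+ i.
have q0 : 0 <= q by rewrite ler0c divr_ge0// ltW.
have q1 : q < 1 by rewrite -[X in _ < X]/(1%:C) ltcR ltr_pdivrMr// mul1r.
have q1C : 0 < 1 - q by rewrite subr_gt0.
have B0 : 0 <= B.
  by rewrite invr_ge0 subr_ge0 -[X in _ <= X]/(1%:C) lecR ler_pdivrMr// mul1r ltW.
have S0 : 0 <= S by apply: sumr_ge0 => i _; exact: exprn_ge0.
have S1 : 0 < S + 1 by rewrite ltr_wpDl.
pose c := e * (1 - q) ^+ 2 / (2 * (S + 1)).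
have c0 : 0 < c by rewrite divr_gt0 ?mulr_gt0 ?exprn_gt0.
have q01 : 0 <= q < 1 by rewrite q0.
have [m mP] := small_pow q01 c0.
exists (fun z => foldr (interp r' m) f (enum 'I_d) z).
  apply: eq_polyfun (foldr_interp_polyfun r' m f 0 (enum_uniq 'I_d)) => z.
  suff -> : mix (enum 'I_d) 0 z = z by [].
  by apply/rowP => i; rewrite mxE mem_enum.
move=> z zr.
have zD : polydisk z.
  by move=> j; apply: le_lt_trans (zr j) _; rewrite -[X in _ < X]/(1%:C) ltcR.
have := foldr_interp_error m hf f1 r0 h1 h2 h3 (enum_uniq 'I_d) zD (fun j _ => zr j).
move=> /le_trans; apply; rewrite size_enum_ord -/q -/B -/S.
apply: le_trans (_ : 2 * c / (1 - q) ^+ 2 * (S + 1) <= _); last first.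
  rewrite (_ : _ * (S + 1) = e)// /c.
  move: (S + 1) (1 - q) (lt0r_neq0 S1) (lt0r_neq0 q1C) => a b a0 b0.
  by field; rewrite a0 b0.
apply: ler_pM => //.
- by rewrite divr_ge0 ?mulr_ge0 ?exprn_ge0// ltW.
- apply: ler_wpM2r; first by rewrite invr_ge0 exprn_ge0// ltW.
  by apply: ler_wpM2l => //; apply/ltW/mP; exact: exp2_ge.
- by rewrite lerDl.
Qed.

End Multi.

(** * Approximation by polynomials bounded by constants below 1 on the torus *)

Section TorusPoly.
Variables (R : realType) (d : nat).
Local Notation C := R[i].
Implicit Types (z : 'rV[C]_d).

Lemma small_invn (c : C) : 0 < c -> exists N, forall k, (N <= k)%N -> k.+1%:R^-1 <= c.
Proof.
move=> c0; have cE : c = (complex.Re c)%:C by rewrite RRe_real// gtr0_real.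
have c'0 : 0 < complex.Re c by rewrite -ltcR -cE.
exists (Num.bound (complex.Re c)^-1) => k Nk.
rewrite -[k.+1%:R](rmorph_nat (real_complex R)) -fmorphV cE lecR /=.
rewrite invf_ple ?posrE ?invr_gt0//.
have /archi_boundP h : 0 <= (complex.Re c)^-1 by rewrite invr_ge0 ltW.
by apply: le_trans (ltW h) _; rewrite ler_nat leqW.
Qed.

Lemma radial_cvg (f : 'rV[C]_d -> C) z (e : C) : holomorphic_on (@polydisk C d) f ->
  polydisk z -> 0 < e ->
  exists2 del : C, 0 < del & forall t : C, `|t - 1| <= del -> `|f z - f (t *: z)| <= e.
Proof.
move=> hf zD e0.
have dg : cdiff (fun t : C => f (t *: z)) 1.
  rewrite (_ : (fun t => _) = f \o (fun u : C => u *: z + 0)); last first.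
    by apply/funext => u /=; rewrite addr0.
  apply: differentiable_comp; first exact: differentiable_upd.
  by rewrite scale1r addr0; exact: hf.
have [L LP] := differentiable_cE dg; have [r r0 rP] := LP 1 ltr01.
have L0 : 0 < `|L| + 1 by rewrite ltr_wpDl.
pose x := r / 2; pose y := e / (`|L| + 1).
have x0 : 0 < x by rewrite divr_gt0.
have y0 : 0 < y by rewrite divr_gt0.
have xy0 : 0 < x + y by rewrite addr_gt0.
(* A positive number below both [x] and [y], obtained without taking a minimum in the partially
   ordered field. *)
exists (x * y / (x + y)); first by apply: divr_gt0 => //; exact: mulr_gt0.
move=> t tle.
have tx : `|t - 1| <= x.
  apply: le_trans tle _; rewrite ler_pdivrMr// ler_pM2l// lerDr ltW//.
have ty : `|t - 1| <= y.
  by apply: le_trans tle _; rewrite ler_pdivrMr// [x * y]mulrC ler_pM2l// lerDl ltW.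
have tr : `|t - 1| < r.
  by apply: le_lt_trans tx _; rewrite ltr_pdivrMr// mulr_natr mulr2n ltrDl.
have := rP t tr; rewrite mul1r /= scale1r => h.
rewrite distrC (_ : f (t *: z) - f z = L * (t - 1) + (f (t *: z) - (f z + L * (t - 1)))); last by ring.
apply: le_trans (ler_normD _ _) _; apply: le_trans (_ : (`|L| + 1) * `|t - 1| <= _).
  by rewrite mulrDl mul1r -normrM lerD2l.
by rewrite mulrC -ler_pdivlMr.
Qed.

(** An approximation within [eps k] at radius [r k] is dilated to the closed unit polydisk, where it
    is at most [1 + eps k]; division by [1 + 2 * eps k] brings it strictly below 1. *)
Lemma torus_poly_approx (f : 'rV[C]_d -> C) :
  holomorphic_on (@polydisk C d) f -> (forall z, polydisk z -> `|f z| <= 1) ->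
  exists P : nat -> seq (C * Zd d), (forall k, nonneg (P k)) /\
    (forall k, exists2 rho : C, 0 <= rho < 1 & forall x, finsup x ->
       normsq (conv (P k) x) <= rho ^+ 2 * normsq x) /\
    (forall z, polydisk z -> forall e : C, 0 < e ->
       exists N, forall k, (N <= k)%N -> `|f z - poly_eval (P k) z| <= e).
Proof.
move=> hf f1.
pose eps (k : nat) : C := k.+1%:R^-1.
pose r (k : nat) : R := 1 - k.+2%:R^-1.
have eps0 k : 0 < eps k by rewrite invr_gt0.
have eps2 k : 0 < 1 + 2 * eps k by rewrite addr_gt0// mulr_gt0.
have k2 k : 0 < k.+2%:R^-1 :> R by rewrite invr_gt0.
have k1 k : k.+2%:R^-1 < 1 :> R by rewrite invf_lt1// ltr1n.
have r0 k : 0 < r k by rewrite subr_gt0.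
have r1 k : r k < 1 by rewrite ltrBlDr ltrDl.
have /choice [F FP] k : exists F, polyfun F /\
    forall z, (forall j, `|z ord0 j| <= (r k)%:C) -> `|f z - F z| <= eps k.
  by have [F pF FP] := polydisk_poly_approx hf f1 (r0 k) (r1 k) (eps0 k); exists F.
have /choice [P PP] k : exists P : seq (C * Zd d), nonneg P /\
    forall z, poly_eval P z = (1 + 2 * eps k)^-1 * F k ((r k)%:C *: z).
  have [pF _] := FP k.
  by have [P Pp PE] := polyfunZ (1 + 2 * eps k)^-1 (polyfun_dilate (r k)%:C pF);
    exists P; split=> // z; rewrite -PE.
have rz k z j : `|z ord0 j| <= 1 -> `|((r k)%:C *: z) ord0 j| <= (r k)%:C.
  by move=> z1; rewrite mxE normrM norm_real_complex [`|r k|]gtr0_norm// ler_piMr// ler0c ltW.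
have rD k z : (forall j, `|z ord0 j| <= 1) -> polydisk ((r k)%:C *: z).
  move=> z1 j; apply: le_lt_trans (rz _ _ _ (z1 j)) _.
  by rewrite -[X in _ < X]/(1%:C) ltcR.
have FD k z : (forall j, `|z ord0 j| <= 1) -> `|F k ((r k)%:C *: z)| <= 1 + eps k.
  move=> z1; rewrite -[F _ _](subKr (f ((r k)%:C *: z))).
  apply: le_trans (ler_normB _ _) _; apply: lerD; first by apply/f1/rD.
  by have [_] := FP k; apply => j; exact: rz.
exists P; split; first by move=> k; have [] := PP k.
split=> [k|z zD e e0].
  exists ((1 + eps k) / (1 + 2 * eps k)).
    rewrite divr_ge0 ?addr_ge0 ?mulr_ge0 ?(ltW (eps0 k))//= ltr_pdivrMr// mul1r.
    by rewrite ltrD2l mulr_natl mulr2n ltrDl.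
  move=> x fx; apply: conv_contraction => //.
    by rewrite divr_ge0 ?addr_ge0 ?mulr_ge0 ?(ltW (eps0 k)).
  move=> z z1; have [_ ->] := PP k.
  rewrite normrM normfV (gtr0_norm (eps2 k)) mulrC; apply: ler_wpM2r.
    by rewrite invr_ge0 ltW.
  by apply: FD => j; rewrite z1.
have z1 j : `|z ord0 j| <= 1 by apply/ltW/zD.
have [|del del0 delP] := radial_cvg (e := e / 2) hf zD; first by rewrite divr_gt0.
have [N1 N1P] := small_invn del0.
(* Half of [e] must cover [eps k] for the approximation and [2 * eps k * 2] for the normalising
   factor, [5 * eps k] in all. *)
have [|N2 N2P] := @small_invn (e / 2 / 5); first by rewrite !divr_gt0.
exists (N1 + N2)%N => k Nk.
have [kN1 kN2] : (N1 <= k)%N /\ (N2 <= k)%N.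
  by split; apply: leq_trans Nk; rewrite ?leq_addr ?leq_addl.
have [_ ->] := PP k; set w := (r k)%:C *: z.
have ek1 : eps k <= 1 by rewrite invf_le1// ler1n.
rewrite (_ : f z - _ = (f z - f w) + ((f w - F k w) + (1 - (1 + 2 * eps k)^-1) * F k w)); last by ring.
apply: le_trans (ler_normD _ _) _; rewrite (_ : e = e / 2 + e / 2); last by field.
apply: lerD.
  apply: delP; rewrite rmorphB rmorph1 addrC addKr normrN norm_real_complex gtr0_norm//.
  rewrite fmorphV rmorph_nat; apply: le_trans (N1P k kN1).
  by rewrite lef_pV2 ?posrE// ler_nat.
apply: le_trans (ler_normD _ _) _.
apply: le_trans (_ : eps k + 2 * eps k * 2 <= _); last first.
  rewrite (_ : _ + _ = eps k * 5); last by ring.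
  by rewrite -ler_pdivlMr//; exact: N2P.
apply: lerD; first by have [_] := FP k; apply => j; exact: rz.
rewrite normrM; apply: ler_pM => //.
  rewrite (_ : 1 - _ = 2 * eps k / (1 + 2 * eps k)); last first.
    by have := lt0r_neq0 (eps2 k); move: (eps k) => y y0; field.
  rewrite ger0_norm ?divr_ge0 ?mulr_ge0 ?(ltW (eps2 k)) ?(ltW (eps0 k))//.
  rewrite ler_pdivrMr// ler_peMr ?mulr_ge0 ?(ltW (eps0 k))//.
  by rewrite lerDl mulr_ge0// ltW.
apply: le_trans (FD k z z1) _.
by rewrite -[2]/(1 + 1) lerD2l.
Qed.

End TorusPoly.

(** * The variational functional *)

Section Value.
Variables (C : numClosedFieldType) (d : nat).
Local Notation Zd := (Zd d).
Local Notation npos := (pos [set: 'I_d]).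
Variables (P : seq (C * Zd)).
Hypothesis P_nonneg : nonneg P.
Implicit Types (a b : Zd) (x y g : Zd -> C).

Definition box (M : nat) a := npos a && [forall j, a j < M%:Z].

Definition of_ords M (k : {ffun 'I_d -> 'I_M}) : Zd := [ffun j => (k j : nat)%:Z].

Lemma box_of_ords M a : box M a -> exists k, a = of_ords (M := M) k.
Proof.
move=> /andP[/posP a0 /forallP aM].
have aN j : (`|a j| < M)%N.
  by have := aM j; have := a0 j (finset.in_setT _); case: (a j).
exists [ffun j => Ordinal (aN j)]; apply/ffunP => j; rewrite !ffunE /=.
by rewrite gez0_abs// a0// finset.in_setT.
Qed.

Lemma of_ords_box M k : box M (of_ords (M := M) k).
Proof.
apply/andP; split; first by apply/posP => j _; rewrite ffunE.
by apply/forallP => j; rewrite ffunE ltz_nat.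
Qed.

Lemma of_ords_inj M : injective (of_ords (M := M)).
Proof. by move=> k l /ffunP kl; apply/ffunP => j; have := kl j; rewrite !ffunE => -[/val_inj]. Qed.

Lemma box_pos M a : box M a -> npos a. Proof. by case/andP. Qed.

Lemma box_le M N a : (M <= N)%N -> box M a -> box N a.
Proof.
move=> MN /andP[pa /forallP aM]; rewrite /box pa; apply/forallP => j.
by apply: lt_le_trans (aM j) _; rewrite lez_nat.
Qed.

Lemma fsum_box M (F : Zd -> C) :
  fsum (fun a => if box M a then F a else 0) = \sum_k F (of_ords (M := M) k).
Proof.
rewrite (@fsumE _ _ [seq of_ords (M := M) k | k <- enum {ffun 'I_d -> 'I_M}]).
- rewrite big_map big_enum; apply: eq_bigr => k _; by rewrite of_ords_box.
- by rewrite map_inj_uniq ?enum_uniq//; exact: of_ords_inj.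
- move=> a; case: ifP => // /box_of_ords[k ->]; rewrite map_f//.
  by rewrite mem_enum.
Qed.

Lemma finsup_box M (F : Zd -> C) : finsup (fun a => if box M a then F a else 0).
Proof.
exists [seq of_ords (M := M) k | k <- enum {ffun 'I_d -> 'I_M}] => a.
by case: ifP => // /box_of_ords[k ->]; rewrite map_f// mem_enum.
Qed.

Lemma finsup_bounded g : finsup g -> exists M, forall a, npos a -> g a != 0 -> box M a.
Proof.
move=> [s sP]; exists (\sum_(a <- s) \sum_j absz (a j)).+1 => a pa ga.
have sa : a \in s by apply: contraNT ga => /sP ->.
rewrite /box pa; apply/forallP => j.
have /posP /(_ j (finset.in_setT _)) := pa => a0.
rewrite -(gez0_abs a0) ltz_nat ltnS (big_rem a sa) /= (bigD1 j)//=.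
by rewrite -!addnA leq_addr.
Qed.

Lemma fsum_expand (A L L' G F : Zd -> C) :
  finsup A -> finsup L -> finsup L' -> finsup G ->
  (forall a, F a = A a - L a - L' a + G a) ->
  fsum F = fsum A - fsum L - fsum L' + fsum G.
Proof.
move=> fA fL fL' fG FE.
have fN g : finsup g -> finsup (fun a => - g a).
  by move=> fg; apply: finsup_sub fg _ => a ->; rewrite oppr0.
have f1 := finsupD fA (fN _ fL); have f2 := finsupD f1 (fN _ fL').
rewrite -(fsumN fL) -(fsumN fL') -fsumD//; last exact: fN.
by rewrite -fsumD//; [rewrite -fsumD//; exact: eq_fsum|exact: fN].
Qed.

Section Points.
Variables (n : nat) (p : 'I_n -> 'rV[C]_d).
Implicit Types (v : 'I_n -> C).

(* With h the element of H^2 whose reproducing pairing is [g |-> sum_i v_i g(p_i)],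
   [lin v g] is <P_+ g, h> and [off g] is |P_- g|^2, so that [Val v x] is
   2 Re <P_+ (P x), h> - |x|^2 + |P_- (P x)|^2. *)
Definition hc v a : C := if npos a then \sum_i v i * mon (p i) a else 0.
Definition lin v g : C := fsum (fun a => hc v a * g a).
Definition off g : C := fsum (fun a => if npos a then 0 else `|g a| ^+ 2).
(** The element h is in general not finitely supported, so |h|^2 enters through its truncations to
    boxes. *)
Definition Szego_trunc M v : C := fsum (fun a => if box M a then `|hc v a| ^+ 2 else 0).
Definition Val v x : C :=
  lin v (conv P x) + (lin v (conv P x))^* - normsq x + off (conv P x).
(** On h, these two changes of coefficients are the adjoints of multiplication by the coordinate
    [j], that is the backward shift, and by the polynomial [P]. *)
Definition shift_coef (j : 'I_d) v (i : 'I_n) : C := v i * p i ord0 j.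
Definition eval_coef v (i : 'I_n) : C := v i * poly_eval P (p i).

Lemma finsup_off g : finsup g -> finsup (fun a => if npos a then 0 else `|g a| ^+ 2).
Proof. by move=> fg; apply: finsup_sub fg _ => a ->; rewrite normr0 expr0n; case: ifP. Qed.

Lemma off_le g : finsup g -> off g <= normsq g.
Proof.
move=> fg; rewrite -subr_ge0 -fsumN; last exact: finsup_off.
rewrite -fsumD; last 2 first.
- exact: finsup_normsq.
- by apply: finsup_sub (finsup_off fg) _ => a ->; rewrite oppr0.
apply: fsum_ge0 => [|a].
  by apply: finsup_sub fg _ => a ->; rewrite normr0 expr0n; case: ifP; rewrite oppr0 addr0.
by case: ifP => _; rewrite ?oppr0 ?addr0 ?subrr// exprn_ge0.
Qed.

Definition residue M v g : C :=
  fsum (fun a => if box M a then `|(hc v a)^* - g a| ^+ 2 else 0).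

(** Completing the square: |h|^2 - 2 Re <P_+ g, h> is |h - P_+ g|^2 - |P_+ g|^2, and |P_+ g|^2 joins
    the [off] term to form |g|^2. The box must contain all frequencies of P_+ g. *)
Lemma Szego_sub_Val M v x : finsup x ->
  (forall a, npos a -> conv P x a != 0 -> box M a) ->
  Szego_trunc M v - Val v x =
  residue M v (conv P x) + (normsq x - normsq (conv P x)).
Proof.
move=> fx xM; set g := conv P x in xM *; have fg : finsup g by exact: finsup_conv.
have f1 : finsup (fun a => hc v a * g a) by exact: finsupMl.
rewrite /Val -/g /Szego_trunc /residue.
have -> : normsq g = fsum (fun a => if npos a then `|g a| ^+ 2 else 0) + off g.
  rewrite -fsumD; last exact: finsup_off.
    by apply: eq_fsum => a; case: ifP; rewrite ?addr0 ?add0r.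
  by apply: finsup_if; exact: finsup_normsq.
suff -> : fsum (fun a => if box M a then `|(hc v a)^* - g a| ^+ 2 else 0) =
    fsum (fun a => if box M a then `|hc v a| ^+ 2 else 0) - lin v g - (lin v g)^* +
    fsum (fun a => if npos a then `|g a| ^+ 2 else 0) by ring.
rewrite fsum_conj//; apply: fsum_expand => //.
- exact: finsup_box.
- exact: finsup_conj.
- by apply: finsup_if; exact: finsup_normsq.
move=> a; case: ifP => [ba|nb].
  by rewrite (box_pos ba) !normCK rmorphB /= conjCK rmorphM /=; ring.
rewrite /hc; case: ifP => pa; last by rewrite !mul0r conjC0 !subr0 addr0.
have -> : g a = 0 by apply/eqP; apply/negP => ga; have := xM a pa; rewrite nb => /(_ (introN idP ga)).
by rewrite mulr0 conjC0 normr0 expr0n /= !subr0 addr0.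
Qed.

Lemma residue_ge0 M v g : 0 <= residue M v g.
Proof.
by apply: fsum_ge0 => [|a]; [exact: finsup_box|case: ifP => // _; exact: exprn_ge0].
Qed.

Lemma hc_shift j v a : npos a -> hc (shift_coef j v) a = hc v (a + unit_vec j).
Proof.
move=> pa; rewrite /hc pa posD ?pos_unit_vec//; apply: eq_bigr => i _.
by rewrite monD ?pos_unit_vec// mon_unit_vec mulrA mulrAC.
Qed.

(** After translation the left side is the part of the right side with frequency at least 1 in
    direction [j]. Adding the unit vector may leave the box [M], whence [M.+1]. *)
Lemma residue_shift M j v g :
  residue M (shift_coef j v) (fun a => g (a + unit_vec j)) <= residue M.+1 v g.
Proof.
rewrite /residue -(fsum_shift (fun a => if box M.+1 a then _ else _) (unit_vec j)).
rewrite -subr_ge0 -fsumN; last exact: finsup_box.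
have f1 := finsup_shift (unit_vec j) (finsup_box M.+1 (fun a => `|(hc v a)^* - g a| ^+ 2)).
have f2 := finsup_box M (fun a => `|(hc (shift_coef j v) a)^* - g (a + unit_vec j)| ^+ 2).
have f2N : finsup (fun a => - (if box M a then
    `|(hc (shift_coef j v) a)^* - g (a + unit_vec j)| ^+ 2 else 0)).
  by apply: finsup_sub f2 _ => a ->; rewrite oppr0.
rewrite -fsumD//; apply: fsum_ge0; first exact: finsupD.
move=> a; case: (boolP (box M a)) => [ba|_]; last first.
  by rewrite oppr0 addr0; case: ifP => // _; exact: exprn_ge0.
have -> : box M.+1 (a + unit_vec j).
  move: ba => /andP[pa /forallP aM]; rewrite /box posD ?pos_unit_vec//.
  apply/forallP => i; rewrite !ffunE -addn1 PoszD; apply: ltr_leD; first exact: aM.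
  by case: (i == j).
by rewrite hc_shift ?subrr//; exact: box_pos ba.
Qed.

Lemma Val_shift M j v x : finsup x ->
  (forall a, npos a -> conv P x a != 0 -> box M a) ->
  (forall a, npos a -> conv P x (a + unit_vec j) != 0 -> box M a) ->
  Szego_trunc M (shift_coef j v) - Val (shift_coef j v) (fun a => x (a + unit_vec j)) <=
  Szego_trunc M.+1 v - Val v x.
Proof.
move=> fx xM xM'.
have fx' := finsup_shift (unit_vec j) fx.
rewrite (Szego_sub_Val (shift_coef j v) fx'); last first.
  by move=> a pa; rewrite conv_shift; exact: xM'.
rewrite (Szego_sub_Val (M := M.+1) v fx); last first.
  by move=> a pa ga; apply: box_le (xM a pa ga).
have -> : normsq (conv P (fun a => x (a + unit_vec j))) = normsq (conv P x).
  rewrite -(normsq_shift (conv P x) (unit_vec j)); congr normsq; apply/funext => a.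
  exact: conv_shift.
rewrite normsq_shift lerD2r.
have -> : conv P (fun a => x (a + unit_vec j)) = (fun a => conv P x (a + unit_vec j)).
  by apply/funext => a; exact: conv_shift.
exact: residue_shift.
Qed.

Lemma linD v g g' : finsup g -> finsup g' ->
  lin v (fun a => g a + g' a) = lin v g + lin v g'.
Proof.
move=> fg fg'; rewrite -fsumD; [|exact: finsupMl|exact: finsupMl].
by apply: eq_fsum => a; rewrite mulrDr.
Qed.

(** Cross terms can arise only from the two squares in [Val]: disjoint supports remove those of
    [normsq], and disjointness of the images outside the orthant removes those of [off]. *)
Lemma Val_add v x y : finsup x -> finsup y ->
  (forall a, x a = 0 \/ y a = 0) ->
  (forall a, ~~ npos a -> conv P x a = 0 \/ conv P y a = 0) ->
  Val v (fun a => x a + y a) = Val v x + Val v y.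
Proof.
move=> fx fy xy cxy; rewrite /Val.
have -> : conv P (fun a => x a + y a) = (fun a => conv P x a + conv P y a).
  by apply/funext => a; exact: convD.
have fcx := finsup_conv P fx; have fcy := finsup_conv P fy.
rewrite linD// rmorphD /=.
have -> : normsq (fun a => x a + y a) = normsq x + normsq y.
  rewrite -fsumD; [|exact: finsup_normsq..]; apply: eq_fsum => a.
  by case: (xy a) => ->; rewrite normr0 ?expr0n ?addr0 ?add0r.
have -> : off (fun a => conv P x a + conv P y a) = off (conv P x) + off (conv P y).
  rewrite -fsumD; [|exact: finsup_off..]; apply: eq_fsum => a.
  case: ifP => pa; first by rewrite addr0.
  by case: (cxy a (negbT pa)) => ->; rewrite normr0 ?expr0n ?addr0 ?add0r.
ring.
Qed.

Lemma pos_unshift (A : {set 'I_d}) j a (B : {set 'I_d}) : j \in A ->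
  pos A a -> pos B (a + unit_vec j) = pos B a.
Proof.
move=> jA /posP aA; apply/idP/idP => [/posP h|h]; last by rewrite posD ?pos_unit_vec.
apply/posP => i iB; have := h i iB; rewrite !ffunE; case: eqP => [->|_]; last by rewrite addr0.
by move=> _; exact: aA.
Qed.

(** Frequencies in H_A are already nonnegative in direction [j], so the forward shift carries none
    of them into the orthant: [off] and the norm are unchanged, and the shift passes to h in the
    linear term. *)
Lemma Val_unshift (A : {set 'I_d}) j v u : j \in A -> finsup u -> supported A u ->
  Val v (fun a => u (a - unit_vec j)) = Val (shift_coef j v) u.
Proof.
move=> jA fu uA; rewrite /Val.
have -> : conv P (fun a => u (a - unit_vec j)) = (fun a => conv P u (a - unit_vec j)).
  by apply/funext => a; exact: conv_shift.
have gA := supported_conv P_nonneg uA; set g := conv P u in gA *.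
have -> : lin v (fun a => g (a - unit_vec j)) = lin (shift_coef j v) g.
  rewrite /lin -(fsum_shift _ (unit_vec j)); apply: eq_fsum => a; rewrite addrK.
  case: (boolP (pos A a)) => [pa|/gA ->]; last by rewrite !mulr0.
  case: (boolP (npos a)) => [qa|qa]; first by rewrite hc_shift.
  by rewrite /hc (pos_unshift _ jA)// (negbTE qa).
rewrite normsq_shift; congr (_ + _).
rewrite /off -(fsum_shift _ (unit_vec j)); apply: eq_fsum => a; rewrite addrK.
case: (boolP (pos A a)) => [pa|/gA ->]; first by rewrite (pos_unshift _ jA).
by rewrite normr0 expr0n !if_same.
Qed.

Lemma lin_conv v w : finsup w -> supported [set: 'I_d] w ->
  lin v (conv P w) = lin (eval_coef v) w.
Proof.
move=> fw wN; rewrite /lin.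
have fp q : finsup (fun a => hc v a * (q.1 * w (a - q.2))).
  by apply: finsupMl; apply: finsupMl; exact: finsup_shift.
under eq_fsum do rewrite /conv mulr_sumr.
rewrite fsum_sum//.
transitivity (\sum_(q <- P) fsum (fun a => q.1 * (if npos a then
    \sum_i v i * mon (p i) q.2 * mon (p i) a else 0) * w a)).
  apply: eq_big_seq => q qP; rewrite -(fsum_shift _ q.2); apply: eq_fsum => a.
  rewrite addrK mulrCA mulrA; case: (boolP (npos a)) => [pa|/wN ->]; last by rewrite !mulr0.
  have pq : npos q.2 by exact: (allP P_nonneg).
  rewrite /hc posD//; congr (_ * _ * _); apply: eq_bigr => i _.
  by rewrite monD// mulrA mulrAC.
rewrite -fsum_sum; last by move=> q; exact: finsupMl.
apply: eq_fsum => a; rewrite -mulr_suml /hc; congr (_ * _).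
case: ifP => _; last by rewrite big1// => q _; rewrite mulr0.
under eq_bigr do rewrite mulr_sumr.
rewrite exchange_big; apply: eq_bigr => i _ /=.
rewrite /eval_coef /poly_eval mulr_sumr mulr_suml; apply: eq_bigr => q _; ring.
Qed.

Lemma Val_supported v w : finsup w -> supported [set: 'I_d] w ->
  Val v w = lin (eval_coef v) w + (lin (eval_coef v) w)^* - normsq w.
Proof.
move=> fw wN; rewrite /Val lin_conv// [off _](_ : _ = 0) ?addr0//.
rewrite -[RHS](fsum0 C d); apply: eq_fsum => a; case: (boolP (npos a)) => // na.
by rewrite (supported_conv P_nonneg wN)// normr0 expr0n.
Qed.

Lemma Val_supported_le M v w : finsup w -> supported [set: 'I_d] w ->
  (forall a, npos a -> w a != 0 -> box M a) ->
  Val v w <= Szego_trunc M (eval_coef v).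
Proof.
move=> fw wN wM; rewrite Val_supported// -subr_ge0.
suff -> : Szego_trunc M (eval_coef v) -
    (lin (eval_coef v) w + (lin (eval_coef v) w)^* - normsq w) =
    residue M (eval_coef v) w by exact: residue_ge0.
rewrite /residue /Szego_trunc; set V := eval_coef v.
have f1 : finsup (fun a => hc V a * w a) by exact: finsupMl.
suff -> : fsum (fun a => if box M a then `|(hc V a)^* - w a| ^+ 2 else 0) =
    fsum (fun a => if box M a then `|hc V a| ^+ 2 else 0) - lin V w - (lin V w)^* +
    normsq w by ring.
rewrite fsum_conj//; apply: fsum_expand => //.
- exact: finsup_box.
- exact: finsup_conj.
- exact: finsup_normsq.
move=> a; case: ifP => [ba|nb].
  by rewrite !normCK rmorphB /= conjCK rmorphM /=; ring.
have -> : w a = 0.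
  case: (boolP (npos a)) => [pa|/wN //]; apply/eqP; apply/negP => wa.
  by have := wM a pa; rewrite nb => /(_ (introN idP wa)).
by rewrite mulr0 conjC0 normr0 expr0n /= !subr0 addr0.
Qed.

(** On H^2 the functional is 2 Re <w, k> - |w|^2, where k is the image of h under the adjoint of
    multiplication by [P]; a truncation of k attains the bound of [Val_supported_le]. *)
Lemma Val_Szego_trunc M v :
  Val v (fun a => if box M a then (hc (eval_coef v) a)^* else 0) =
  Szego_trunc M (eval_coef v).
Proof.
set V := eval_coef v; rewrite Val_supported//.
- have -> : lin V (fun a => if box M a then (hc V a)^* else 0) = Szego_trunc M V.
    by apply: eq_fsum => a; case: ifP => _; rewrite ?mulr0// normCK.
  have -> : normsq (fun a => if box M a then (hc V a)^* else 0) = Szego_trunc M V.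
    by apply: eq_fsum => a; case: ifP => _; rewrite ?norm_conjC// normr0 expr0n.
  suff -> : (Szego_trunc M V)^* = Szego_trunc M V by rewrite addrK.
  apply: geC0_conj; apply: fsum_ge0 => [|a]; first exact: finsup_box.
  by case: ifP => // _; exact: exprn_ge0.
- exact: finsup_box.
- by move=> a na; case: ifP => // /box_pos; rewrite (negbTE na).
Qed.

End Points.
End Value.

(** * Limits along ultrafilters and quadratic forms of kernels *)

Section Tends.
Local Open Scope classical_set_scope.
Variables (K : numFieldType) (T : Type) (F : set_system T).
Context {FF : ProperFilter F}.

Definition tends (u : T -> K) (l : K) : Prop := u @ F --> l.

Lemma tendsP (u : T -> K) (l : K) :
  tends u l <-> forall e, 0 < e -> F [set n | `|l - u n| <= e].
Proof. by rewrite /tends; exact: cvgrPdist_le. Qed.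

Lemma tends_cst (c : K) : tends (fun=> c) c.
Proof. exact: cvg_cst. Qed.

Lemma tendsD (u v : T -> K) a b : tends u a -> tends v b ->
  tends (fun n => u n + v n) (a + b).
Proof. exact: cvgD. Qed.

Lemma tendsB (u v : T -> K) a b : tends u a -> tends v b ->
  tends (fun n => u n - v n) (a - b).
Proof. exact: cvgB. Qed.

Lemma tendsM (u v : T -> K) a b : tends u a -> tends v b ->
  tends (fun n => u n * v n) (a * b).
Proof. exact: cvgM. Qed.

Lemma tends_sum (I : Type) (r : seq I) (u : I -> T -> K) (a : I -> K) :
  (forall i, tends (u i) (a i)) ->
  tends (fun n => \sum_(i <- r) u i n) (\sum_(i <- r) a i).
Proof.
move=> ua; elim: r => [|i r IH].
  rewrite big_nil (_ : (fun n => _) = (fun=> 0)); first exact: tends_cst.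
  by apply/funext => n; rewrite big_nil.
rewrite big_cons (_ : (fun n => _) = (fun n => u i n + \sum_(i <- r) u i n)).
  exact: tendsD.
by apply/funext => n; rewrite big_cons.
Qed.

Lemma tends_prod (I : Type) (r : seq I) (u : I -> T -> K) (a : I -> K) :
  (forall i, tends (u i) (a i)) ->
  tends (fun n => \prod_(i <- r) u i n) (\prod_(i <- r) a i).
Proof.
move=> ua; elim: r => [|i r IH].
  rewrite big_nil (_ : (fun n => _) = (fun=> 1)); first exact: tends_cst.
  by apply/funext => n; rewrite big_nil.
rewrite big_cons (_ : (fun n => _) = (fun n => u i n * \prod_(i <- r) u i n)).
  exact: tendsM.
by apply/funext => n; rewrite big_cons.
Qed.

End Tends.
Arguments tends_cst {K T} F {FF} c [t] _.

Section ComplexLimits.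
Local Open Scope classical_set_scope.
Variable R : realType.
Local Notation C := R[i].

Lemma norm_imag : `|'i%C : C| = 1.
Proof. by apply/eqP; rewrite -sqrp_eq1// -normrX sqr_i normrN1. Qed.

Lemma tends_conj (T : Type) (F : set_system T) {FF : ProperFilter F} (u : T -> C) (l : C) :
  tends F u l -> tends F (fun n => (u n)^*) l^*.
Proof.
move=> /tendsP h; apply/tendsP => e /h; apply: filterS => n /=.
by rewrite -rmorphB norm_conjC.
Qed.

Lemma tends_ge0 (T : Type) (F : set_system T) {FF : ProperFilter F} (u : T -> C) (l : C) :
  tends F u l -> F [set n | 0 <= u n] -> 0 <= l.
Proof.
move=> /tendsP h u0.
have near (e : R) : 0 < e -> `|complex.Im l| <= e /\ - e <= complex.Re l.
  move=> e0; have eC : 0 < e%:C :> C by rewrite ltcR.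
  have [n [/= n1 n2]] := filter_ex (filterI (h _ eC) u0).
  move: n2 n1; case: (u n) => c d; case: l {h} => a b; rewrite lecE /= => /andP[/eqP -> c0].
  move=> le1; have := le_trans (normc_ge_Re _) le1; rewrite lecR /= => lR.
  have lI : `|b| <= e.
    have := le_trans (normc_ge_Re (Complex (a - c) (b - 0) * 'i%C)) _.
    rewrite ReiNIm /= subr0 normrN => H; rewrite -lecR; apply: H.
    rewrite normrM norm_imag mulr1 (_ : Complex (a - c) b = Complex a b - Complex c 0)//.
    by rewrite -[RHS]/(Complex (a - c) (b - 0)) subr0.
  by split=> //; move: lR; rewrite ler_norml => /andP[]; lra.
have bI : complex.Im l = 0.
  apply/eqP; rewrite -normr_le0; apply/ler_addgt0Pr => e e0; rewrite add0r.
  by have [] := near e e0.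
rewrite lecE /= bI eqxx /=; apply/ler_addgt0Pr => e e0.
by have [_] := near e e0; lra.
Qed.

Lemma tends_le (T : Type) (F : set_system T) {FF : ProperFilter F} (u v : T -> C) (a b : C) :
  tends F u a -> tends F v b -> F [set n | u n <= v n] -> a <= b.
Proof.
move=> ua vb uv; rewrite -subr_ge0; apply: (tends_ge0 (tendsB vb ua)).
by apply: filterS uv => n /=; rewrite subr_ge0.
Qed.

(** The limit is the supremum of the numbers that bound [u] from below on a set of [U]. *)
Lemma ultra_cvg_real (T : Type) (U : set_system T) {UU : UltraFilter U} (u : T -> R) (B : R) :
  (forall n, `|u n| <= B) -> exists l, forall e, 0 < e -> U [set n | `|l - u n| <= e].
Proof.
move=> uB; pose E := [set x | U [set n | x <= u n]].
have E0 : E (- B).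
  by apply: filterS filterT => n _ /=; have := uB n; rewrite ler_norml => /andP[].
have EB : ubound E B.
  move=> x /= Ux; have [n /= xn] := filter_ex Ux.
  by apply: le_trans xn _; have := uB n; rewrite ler_norml => /andP[].
have supE : has_sup E by split; [exists (- B)|exists B].
exists (sup E) => e e0.
have U1 : U [set n | sup E - e <= u n].
  have [x Ex xe] := sup_adherent e0 supE.
  by apply: filterS Ex => n /= xn; apply: le_trans (ltW xe) xn.
have U2 : U (~` [set n | sup E + e <= u n]).
  have [h|//] := in_ultra_setVsetC [set n | sup E + e <= u n] UU.
  have := ub_le_sup (proj2 supE) h; lra.
apply: filterS (filterI U1 U2) => n [/= h1 /negP]; rewrite -ltNge => h2.
by rewrite ler_norml; lra.
Qed.

Lemma ultra_cvg (T : Type) (U : set_system T) {UU : UltraFilter U} (u : T -> C) (B : C) :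
  (forall n, `|u n| <= B) -> exists l, tends U u l.
Proof.
move=> uB.
have BE n : `|u n| <= (complex.Re B)%:C.
  by rewrite RRe_real// ger0_real//; apply: le_trans (uB n).
have [n|a aP] := @ultra_cvg_real _ U _ (fun n => complex.Re (u n)) (complex.Re B).
  by rewrite -lecR; apply: le_trans (normc_ge_Re _) (BE n).
have [n|b bP] := @ultra_cvg_real _ U _ (fun n => complex.Im (u n)) (complex.Re B).
  rewrite -lecR -normrN -ReiNIm; apply: le_trans (normc_ge_Re _) _.
  by rewrite normrM norm_imag mulr1.
exists (Complex a b); apply/tendsP => e e0.
have eE : e = (complex.Re e)%:C by rewrite RRe_real// gtr0_real.
have e1 : 0 < complex.Re e / 2 by rewrite divr_gt0// -ltcR -eE.
apply: filterS (filterI (aP _ e1) (bP _ e1)) => n [/= h1 h2].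
case: (u n) h1 h2 => c d /= h1 h2; rewrite eE.
apply: le_trans (le_normReIm _ _) _; rewrite lecR; lra.
Qed.

(** Kernels have uncountably many entries; a single ultrafilter makes all bounded ones converge,
    with no extraction of subsequences. *)
Lemma nat_ultrafilter : exists2 U : set_system nat, UltraFilter U & \oo `<=` U.
Proof. by have [U [UU h]] := @ultraFilterLemma nat \oo _; exists U. Qed.

End ComplexLimits.

Section QuadraticForms.
Variables (C : numClosedFieldType) (d : nat).
Implicit Types (K L : kernel C d).

Definition qf K n (p : 'I_n -> 'rV[C]_d) (v : 'I_n -> C) : C :=
  \sum_i \sum_j v i * K (p i) (p j) * (v j)^*.

Lemma qfB K L n p (v : 'I_n -> C) :
  qf (fun z w => K z w - L z w) p v = qf K p v - qf L p v.
Proof.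
rewrite /qf -sumrB; apply: eq_bigr => i _; rewrite -sumrB; apply: eq_bigr => j _; ring.
Qed.

Lemma qf_coef K (g : 'rV[C]_d -> C) n p (v : 'I_n -> C) :
  qf (fun z w => g z * (g w)^* * K z w) p v = qf K p (fun i => v i * g (p i)).
Proof.
by apply: eq_bigr => i _; apply: eq_bigr => j _; rewrite rmorphM /=; ring.
Qed.

Lemma qf_shift K j n p (v : 'I_n -> C) :
  qf (fun z w => (1 - z ord0 j * (w ord0 j)^*) * K z w) p v =
  qf K p v - qf K p (shift_coef p j v).
Proof.
rewrite -(qf_coef K (fun z => z ord0 j)) -qfB.
by apply: eq_bigr => i _; apply: eq_bigr => k _; ring.
Qed.

Lemma psd_kernelP K : (forall n (p : 'I_n -> 'rV[C]_d) (v : 'I_n -> C),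
  (forall i, polydisk (p i)) -> 0 <= qf K p v) -> psd_kernel K.
Proof.
move=> h n p _ pD v; apply: le_trans (h n p (fun i => v ord0 i) pD) _.
rewrite le_eqVlt; apply/orP; left; apply/eqP.
rewrite mxE /qf exchange_big; apply: eq_bigr => j _; rewrite !mxE mulr_suml.
by apply: eq_bigr => i _; rewrite !mxE.
Qed.

Definition Szego : kernel C d :=
  fun z w => (\prod_j (1 - z ord0 j * (w ord0 j)^*))^-1.

Definition two_points (z w : 'rV[C]_d) (i : 'I_2) := if i == ord0 then z else w.
Definition two_coefs (b : C) (i : 'I_2) := if i == ord0 then 1 else b.

Lemma qf_two_points K (z w : 'rV[C]_d) (b : C) : b * b^* = 1 ->
  b * qf K (two_points z w) (two_coefs b) =
  b * K z z + K z w + b ^+ 2 * K w z + b * K w w.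
Proof.
move=> b1; rewrite /qf !big_ord_recl !big_ord0 /two_points /two_coefs /= conjC1.
rewrite !addr0 !mulr1 !mul1r mulrDr !mulrDr.
rewrite [b * (K z w * _)]mulrCA b1 mulr1 expr2 !mulrA.
by rewrite -[b * b * K w w * _]mulrA mulrAC [b * b]mulrC; ring: b1.
Qed.

(** Over the fourth roots of unity both [b] and [b ^+ 2] sum to 0, so only the entry at [(z, w)]
    survives in [qf_two_points]. *)
Lemma polarization K (z w : 'rV[C]_d) :
  4 * K z w =
  1 * qf K (two_points z w) (two_coefs 1) + 'i * qf K (two_points z w) (two_coefs 'i)
  + (-1) * qf K (two_points z w) (two_coefs (-1))
  + (- 'i) * qf K (two_points z w) (two_coefs (- 'i)).
Proof.
have i2 := @sqrCi C.
have ii : 'i * 'i^* = 1 :> C by rewrite conjCi mulrN -expr2 i2 opprK.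
have n1 : (-1) * (-1)^* = 1 :> C by rewrite rmorphN rmorph1 mulrNN mulr1.
have ni : (- 'i) * (- 'i)^* = 1 :> C by rewrite rmorphN mulrNN.
have o1 : 1 * 1^* = 1 :> C by rewrite conjC1 mulr1.
by rewrite !qf_two_points// !sqrrN i2 expr1n; ring.
Qed.

(** Domination of forms bounds the entries by a quantity that depends on [L] alone; this is what
    [ultra_cvg] needs for a sequence of kernels below [L]. *)
Lemma kernel_bound K L (z w : 'rV[C]_d) :
  (forall n (p : 'I_n -> 'rV[C]_d) (v : 'I_n -> C), (forall i, polydisk (p i)) ->
     0 <= qf K p v <= qf L p v) -> polydisk z -> polydisk w ->
  `|K z w| <= qf L (two_points z w) (two_coefs 1) + qf L (two_points z w) (two_coefs 'i)
    + qf L (two_points z w) (two_coefs (-1)) + qf L (two_points z w) (two_coefs (- 'i)).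
Proof.
move=> KL zD wD.
have pD i : polydisk (two_points z w i) by rewrite /two_points; case: ifP.
apply: le_trans (_ : `|4 * K z w| <= _).
  by rewrite normrM normr_nat ler_peMl// ler1n.
have b (c : C) : `|c| = 1 -> `|c * qf K (two_points z w) (two_coefs c)| <=
    qf L (two_points z w) (two_coefs c).
  move=> c1; have /andP[h0 h1] := KL _ _ (two_coefs c) pD.
  by rewrite normrM c1 mul1r ger0_norm.
rewrite polarization; do 3?[apply: le_trans (ler_normD _ _) _; apply: lerD];
  by apply: b; rewrite ?normrN ?normCi ?normr1.
Qed.

End QuadraticForms.

(** * The Szego kernel as a limit of truncations *)

Section SzegoLimit.
Local Open Scope classical_set_scope.
Variables (R : realType) (d : nat).
Local Notation C := R[i].

Lemma tends_qf (T : Type) (F : set_system T) {FF : ProperFilter F}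
    (K : T -> kernel C d) (L : kernel C d) n (p : 'I_n -> 'rV[C]_d) (v : 'I_n -> C) :
  (forall i j, tends F (fun m => K m (p i) (p j)) (L (p i) (p j))) ->
  tends F (fun m => qf (K m) p v) (qf L p v).
Proof.
move=> KL; apply: tends_sum => i; apply: tends_sum => j.
by apply: tendsM; [apply: tendsM => //; exact: tends_cst|exact: tends_cst].
Qed.

Definition Szego_partial (M : nat) : kernel C d :=
  fun z w => \prod_j \sum_(k < M) (z ord0 j * (w ord0 j)^*) ^+ k.

(** A box is a product of intervals: expanding a product of finite geometric sums yields its
    monomials. *)
Lemma Szego_truncE n (p : 'I_n -> 'rV[C]_d) M v :
  Szego_trunc p M v = qf (Szego_partial M) p v.
Proof.
rewrite /Szego_trunc (fsum_box _ (fun a => `|hc p v a| ^+ 2)).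
under eq_bigr do rewrite /hc (box_pos (of_ords_box _)) normCK rmorph_sum mulr_suml.
rewrite exchange_big; apply: eq_bigr => i _ /=.
under eq_bigr do rewrite mulr_sumr.
rewrite exchange_big; apply: eq_bigr => j _ /=.
rewrite /Szego_partial bigA_distr_bigA mulr_sumr mulr_suml.
apply: eq_bigr => k _; rewrite rmorphM /=.
suff -> : \prod_i0 (p i ord0 i0 * (p j ord0 i0)^*) ^+ k i0 =
    mon (p i) (of_ords k) * (mon (p j) (of_ords k))^* by ring.
rewrite /mon rmorph_prod -big_split; apply: eq_bigr => l _ /=.
by rewrite ffunE exprMn -rmorphXn.
Qed.

Lemma tends_geom (q : C) : `|q| < 1 -> tends \oo (fun M => \sum_(k < M) q ^+ k) (1 - q)^-1.
Proof.
move=> q1; apply/tendsP => e e0.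
have q0 : 1 - q != 0 by rewrite subr_eq0; apply: contraTneq q1 => <-; rewrite normr1 ltxx.
have c0 : 0 < e * `|1 - q| by rewrite mulr_gt0// normr_gt0.
have q01 : 0 <= `|q| < 1 by rewrite normr_ge0.
have [N NP] := small_pow q01 c0; exists N => // M /= NM.
have -> : (1 - q)^-1 - \sum_(k < M) q ^+ k = q ^+ M / (1 - q).
  apply: (mulfI q0); rewrite mulrBr divff// [RHS]mulrC divfK//.
  by rewrite -[(1 - q) * _]opprK -mulNr opprB -subrX1 opprB; ring.
by rewrite normrM normfV normrX ler_pdivrMr ?normr_gt0//; apply/ltW/NP.
Qed.

Lemma tends_Szego z w : polydisk z -> polydisk w ->
  tends \oo (fun M => Szego_partial M z w) (@Szego C d z w).
Proof.
move=> zD wD; rewrite /Szego -prodfV; apply: tends_prod => j; apply: tends_geom.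
by rewrite normrM norm_conjC mulr_ilt1.
Qed.

Lemma tends_Szego_trunc n (p : 'I_n -> 'rV[C]_d) v : (forall i, polydisk (p i)) ->
  tends \oo (fun M => Szego_trunc p M v) (qf (@Szego C d) p v).
Proof.
move=> pD; rewrite (_ : (fun M => _) = (fun M => qf (Szego_partial M) p v)).
  by apply: tends_qf => i j; exact: tends_Szego.
by apply/funext => M; exact: Szego_truncE.
Qed.

End SzegoLimit.

(** * Maximising the functional at a finite level *)

Section PositiveDefinite.
Variables (C : numClosedFieldType).

Definition adj m n (A : 'M[C]_(m, n)) : 'M[C]_(n, m) := (map_mx Num.conj A)^T.

Lemma adjE m n (A : 'M[C]_(m, n)) i j : adj A i j = (A j i)^*.
Proof. by rewrite !mxE. Qed.

Lemma adjK m n (A : 'M[C]_(m, n)) : adj (adj A) = A.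
Proof. by apply/matrixP => i j; rewrite !adjE conjCK. Qed.

Lemma adj_mul m n k (A : 'M[C]_(m, n)) (B : 'M[C]_(n, k)) :
  adj (A *m B) = adj B *m adj A.
Proof. by rewrite /adj map_mxM trmx_mul. Qed.

Lemma adjB m n (A B : 'M[C]_(m, n)) : adj (A - B) = adj A - adj B.
Proof. by rewrite /adj map_mxB linearB. Qed.

Variables (n : nat) (G : 'M[C]_n).
Hypothesis G_herm : adj G = G.
Hypothesis G_pos : forall y : 'rV[C]_n, y != 0 -> 0 < (y *m G *m adj y) ord0 ord0.

Lemma pd_unitmx : G \in unitmx.
Proof.
rewrite -row_free_unit; apply: inj_row_free => y yG; apply/eqP; apply: contraT => y0.
by have := G_pos y0; rewrite yG mul0mx mxE ltxx.
Qed.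

Lemma adj_invmx : adj (invmx G) = invmx G.
Proof.
have GU := pd_unitmx.
have h : adj (invmx G) *m G = 1%:M.
  rewrite -[X in _ *m X]G_herm -adj_mul mulmxV// /adj map_mx1 trmx1//.
by rewrite -[LHS](mulmxK GU) h mul1mx.
Qed.

Definition quad (c y : 'rV[C]_n) : C :=
  (y *m adj c + c *m adj y - y *m G *m adj y) ord0 ord0.

(** The difference is the form of [G] at [y - c *m invmx G]. *)
Lemma quad_le c y : quad c y <= (c *m invmx G *m adj c) ord0 ord0.
Proof.
have GU := pd_unitmx; rewrite -subr_ge0.
pose z := y - c *m invmx G.
have -> : (c *m invmx G *m adj c) ord0 ord0 - quad c y = (z *m G *m adj z) ord0 ord0.
  have e1 : z *m G = y *m G - c by rewrite mulmxBl mulmxKV.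
  have e2 : adj z = adj y - invmx G *m adj c by rewrite adjB adj_mul adj_invmx.
  rewrite e1 e2 mulmxBl !mulmxBr /quad !mulmxA mulmxK//.
  move: (c *m _ *m _) (y *m G *m _) (y *m adj c) (c *m adj y) => a1 a2 a3 a4.
  by rewrite !mxE; ring.
have [->|z0] := eqVneq z 0; first by rewrite !mul0mx mxE.
exact/ltW/G_pos.
Qed.

Lemma quad_max c : quad c (c *m invmx G) = (c *m invmx G *m adj c) ord0 ord0.
Proof.
have GU := pd_unitmx.
by rewrite /quad adj_mul adj_invmx mulmxKV// mulmxA addrK.
Qed.

End PositiveDefinite.

Section FiniteSup.
Variables (C : numClosedFieldType) (d : nat).
Local Notation Zd := (Zd d).
Local Notation npos := (pos [set: 'I_d]).
Variables (P : seq (C * Zd)) (rho : C) (A : {set 'I_d}).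
Hypothesis rho01 : 0 <= rho < 1.
Hypothesis P_contr : forall x, finsup x -> normsq (conv P x) <= rho ^+ 2 * normsq x.
Implicit Types (a b : Zd) (x g : Zd -> C).

(* The indices [i] that do not encode a lattice point of H_A give the zero
   function; [gram] therefore uses the norm of the coefficients, not that of
   their combination, in order to stay invertible. *)
Definition bas (i : nat) a : C :=
  if (pickle_inv i == Some a :> option Zd) && pos A a then 1 else 0.

Definition valid (i : nat) : bool :=
  if pickle_inv i is Some a then pos A (a : Zd) else false.

Lemma finsup_bas i : finsup (bas i).
Proof.
exists (if pickle_inv i is Some a then [:: a] else [::]) => a; rewrite /bas.
case: (pickle_inv i) => [b|] //=; rewrite inE => ab.
by rewrite (inj_eq Some_inj) eq_sym (negbTE ab).
Qed.

Lemma fsum_bas i k : fsum (fun a => bas i a * (bas k a)^*) = ((i == k) && valid i)%:R.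
Proof.
rewrite /valid; case E : (pickle_inv i) => [b|]; last first.
  rewrite andbF -[RHS](fsum0 C d); apply: eq_fsum => a; rewrite /bas E /=.
  by rewrite mul0r.
rewrite -[RHS](fsum_delta _ b); apply: eq_fsum => a; rewrite /bas E (inj_eq Some_inj).
have [ab|ab] := eqVneq b a; last by rewrite mul0r.
subst b; case: (boolP (pos A a)) => pa; last by rewrite !andbF !mul0r.
have [<-|ik] := eqVneq i k; first by rewrite E eqxx conjC1 mulr1.
rewrite mul1r; case: eqP => [E2|_] /=; last by rewrite conjC0.
have := @pickle_invK Zd i; have := @pickle_invK Zd k.
by rewrite /oapp E E2 => k1 k2; case/eqP: ik; rewrite -k1 -k2.
Qed.

Section Level.
Variable n : nat.
Implicit Types (y : 'rV[C]_n).

Definition comb y a : C := \sum_(i < n) y ord0 i * bas i a.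

Lemma finsup_comb y : finsup (comb y).
Proof.
apply: (finsup_sum _ (F := fun (i : 'I_n) a => y ord0 i * bas i a)) => i.
by apply: finsupMl; exact: finsup_bas.
Qed.

Lemma supported_comb y : supported A (comb y).
Proof. by move=> a na; rewrite /comb big1// => i _; rewrite /bas (negbTE na) andbF mulr0. Qed.

Lemma conv_comb y a : conv P (comb y) a = \sum_(i < n) y ord0 i * conv P (bas i) a.
Proof. by rewrite conv_sum; apply: eq_bigr => i _; rewrite convZ. Qed.

(** Coordinate [i] is the value at [z] of P_+ applied to [P] times the basis function [i]. *)
Definition evec (z : 'rV[C]_d) : 'rV[C]_n :=
  \row_i fsum (fun a => if npos a then mon z a * conv P (bas i) a else 0).

Definition gram : 'M[C]_n := \matrix_(i, k) ((i == k)%:R -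
  fsum (fun a => if npos a then 0 else conv P (bas i) a * (conv P (bas k) a)^*)).

Definition cvec m (p : 'I_m -> 'rV[C]_d) (v : 'I_m -> C) : 'rV[C]_n :=
  \row_i (\sum_l v l * evec (p l) ord0 i)^*.

Definition norm2 y : C := \sum_i `|y ord0 i| ^+ 2.

Let fcb i := finsup_conv P (finsup_bas i).

Lemma lin_comb m (p : 'I_m -> 'rV[C]_d) v y :
  lin p v (conv P (comb y)) = (y *m adj (cvec p v)) ord0 ord0.
Proof.
rewrite mxE /lin; under eq_fsum do rewrite conv_comb mulr_sumr.
rewrite fsum_sum; last by move=> i; apply: finsupMl; exact: finsupMl.
apply: eq_bigr => i _; rewrite adjE mxE conjCK.
have fe l : finsup (fun a => if npos a then mon (p l) a * conv P (bas i) a else 0).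
  by apply: finsup_if; apply: finsupMl; exact: fcb.
transitivity (y ord0 i * fsum (fun a => hc p v a * conv P (bas i) a)).
  rewrite -fsumZ; last by apply: finsupMl; exact: fcb.
  by apply: eq_fsum => a; rewrite mulrCA.
congr (_ * _); under [RHS]eq_bigr do rewrite mxE -fsumZ//.
rewrite -fsum_sum; last by move=> l; exact: finsupMl.
apply: eq_fsum => a; rewrite /hc; case: ifP => _.
  by rewrite mulr_suml; apply: eq_bigr => l _; rewrite mulrA.
by rewrite mul0r big1// => l _; rewrite mulr0.
Qed.

Lemma off_comb y : off (conv P (comb y)) =
  \sum_(i < n) \sum_(k < n) y ord0 i * fsum (fun a => if npos a then 0 else
     conv P (bas i) a * (conv P (bas k) a)^*) * (y ord0 k)^*.
Proof.
have fe i k : finsup (fun a => if npos a then 0 else conv P (bas i) a * (conv P (bas k) a)^*).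
  by apply: finsup_sub (fcb i) _ => a ->; rewrite mul0r if_same.
transitivity (fsum (fun a => \sum_(i < n) \sum_(k < n) y ord0 i * (y ord0 k)^* *
    (if npos a then 0 else conv P (bas i) a * (conv P (bas k) a)^*))).
  apply: eq_fsum => a; case: ifP => _.
    by rewrite big1// => i _; rewrite big1// => k _; rewrite mulr0.
  rewrite normCK conv_comb rmorph_sum mulr_suml; apply: eq_bigr => i _.
  by rewrite mulr_sumr; apply: eq_bigr => k _; rewrite rmorphM /=; ring.
rewrite fsum_sum; last by move=> i; apply: finsup_sum => k; exact: finsupMl.
apply: eq_bigr => i _; rewrite fsum_sum; last by move=> k; exact: finsupMl.
by apply: eq_bigr => k _; rewrite fsumZ//; ring.
Qed.

Lemma normsq_comb y : normsq (comb y) = \sum_i `|y ord0 i| ^+ 2 * (valid i)%:R.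
Proof.
have fe i k : finsup (fun a => bas i a * (bas k a)^*).
  by apply: finsup_sub (finsup_bas i) _ => a ->; rewrite mul0r.
transitivity (fsum (fun a => \sum_(i < n) \sum_(k < n) y ord0 i * (y ord0 k)^* *
    (bas i a * (bas k a)^*))).
  apply: eq_fsum => a.
  rewrite normCK /comb rmorph_sum mulr_suml; apply: eq_bigr => i _.
  by rewrite mulr_sumr; apply: eq_bigr => k _; rewrite rmorphM /=; ring.
rewrite fsum_sum; last by move=> i; apply: finsup_sum => k; exact: finsupMl.
apply: eq_bigr => i _; rewrite fsum_sum; last by move=> k; exact: finsupMl.
rewrite (bigD1 i)//= big1 ?addr0 => [|k ki]; rewrite fsumZ// fsum_bas.
  by rewrite eqxx -normCK.
by rewrite eq_sym (negbTE ki : (val k == val i) = false) mulr0.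
Qed.

Lemma normsq_comb_le y : normsq (comb y) <= norm2 y.
Proof.
rewrite normsq_comb; apply: ler_sum => i _; rewrite ler_piMr ?exprn_ge0//.
by case: (valid i).
Qed.

Lemma gram_form y : (y *m gram *m adj y) ord0 ord0 = norm2 y - off (conv P (comb y)).
Proof.
rewrite off_comb /norm2 mxE.
under eq_bigr do rewrite adjE mxE mulr_suml.
rewrite exchange_big -sumrB; apply: eq_bigr => i _ /=.
under eq_bigr do rewrite mxE mulrBr mulrBl.
rewrite sumrB; congr (_ - _).
rewrite (bigD1 i)//= big1 ?addr0 => [|k ki]; first by rewrite eqxx mulr1 -normCK.
by rewrite eq_sym (negbTE ki) mulr0 mul0r.
Qed.

Lemma gram_herm : adj gram = gram.
Proof.
apply/matrixP => i k; rewrite adjE !mxE rmorphB rmorph_nat eq_sym; congr (_ - _).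
rewrite /= fsum_conj; last by apply: finsup_sub (fcb k) _ => a ->; rewrite mul0r if_same.
apply: eq_fsum => a.
case: (npos a).
  exact: conjC0.
by rewrite rmorphM /= conjCK mulrC.
Qed.

(** Here [rho < 1] is decisive: |P_- (P x)|^2 is at most [rho ^+ 2] times the norm of the
    coefficients. *)
Lemma gram_pos y : y != 0 -> 0 < (y *m gram *m adj y) ord0 ord0.
Proof.
move=> y0; rewrite gram_form subr_gt0.
have /andP[r0 r1] := rho01.
have fc := finsup_conv P (finsup_comb y).
apply: le_lt_trans (off_le fc) _; apply: le_lt_trans (P_contr (finsup_comb y)) _.
apply: le_lt_trans (ler_wpM2l (exprn_ge0 2 r0) (normsq_comb_le y)) _.
have N0 : 0 < norm2 y.
  have [i yi] : exists i, y ord0 i != 0.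
    apply/existsP; apply: contraNT y0 => /existsPn h; apply/eqP/rowP => i; rewrite mxE.
    by apply/eqP; have := h i; rewrite negbK.
  rewrite /norm2 (bigD1 i)//= ltr_wpDr ?exprn_gt0 ?normr_gt0//.
  by apply: sumr_ge0 => k _; exact: exprn_ge0.
by rewrite gtr_pMl// exprn_ilt1.
Qed.

(** The maximum of [quad] at [cvec p v] is a quadratic form in [v], since [cvec] is conjugate-linear
    in [v]; this is the kernel of that form. *)
Definition level_kernel : kernel C d := fun z w =>
  (map_mx Num.conj (evec w) *m invmx gram *m (evec z)^T) ord0 ord0.

Lemma qf_level_kernel m (p : 'I_m -> 'rV[C]_d) v :
  qf level_kernel p v = (cvec p v *m invmx gram *m adj (cvec p v)) ord0 ord0.
Proof.
have -> : cvec p v = \sum_l (v l)^* *: map_mx Num.conj (evec (p l)).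
  apply/rowP => i; rewrite mxE summxE rmorph_sum; apply: eq_bigr => l _.
  by rewrite rmorphM !mxE.
rewrite mulmx_suml mulmx_suml summxE /qf exchange_big; apply: eq_bigr => l _ /=.
rewrite -!scalemxAl mxE.
rewrite (_ : adj _ = \sum_l v l *: (evec (p l))^T); last first.
  apply/matrixP => i j; rewrite adjE ord1 !summxE rmorph_sum; apply: eq_bigr => k _.
  by rewrite !mxE rmorphM /= !conjCK.
rewrite mulmx_sumr summxE mulr_sumr; apply: eq_bigr => k _.
by rewrite -scalemxAr [in RHS]mxE /level_kernel; ring.
Qed.

Lemma quad_comb m (p : 'I_m -> 'rV[C]_d) v y :
  quad gram (cvec p v) y = lin p v (conv P (comb y)) + (lin p v (conv P (comb y)))^*
    - norm2 y + off (conv P (comb y)).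
Proof.
rewrite /quad [LHS]mxE [in LHS]mxE lin_comb.
have -> : (cvec p v *m adj y) ord0 ord0 = ((y *m adj (cvec p v)) ord0 ord0)^*.
  by rewrite -adjE adj_mul adjK.
by rewrite [X in _ + X]mxE gram_form; ring.
Qed.

Lemma level_kernel_attained m (p : 'I_m -> 'rV[C]_d) v :
  exists y, qf level_kernel p v <= Val P p v (comb y).
Proof.
exists (cvec p v *m invmx gram).
rewrite qf_level_kernel -(quad_max gram_herm gram_pos) quad_comb /Val lerD2r lerD2l lerN2.
exact: normsq_comb_le.
Qed.

(** Coefficients at indices that encode no point of H_A count in [norm2] but not in [comb]; the
    hypothesis says that they vanish, so that [quad] and [Val] agree. *)
Lemma level_kernel_ge m (p : 'I_m -> 'rV[C]_d) v y : norm2 y = normsq (comb y) ->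
  Val P p v (comb y) <= qf level_kernel p v.
Proof.
move=> Ny; rewrite qf_level_kernel.
apply: le_trans (quad_le gram_herm gram_pos _ y).
by rewrite quad_comb /Val Ny.
Qed.

End Level.

Lemma comb_cover x : finsup x -> supported A x -> exists N, forall n, (N <= n)%N ->
  exists2 y : 'rV[C]_n, comb y = x & norm2 y = normsq (comb y).
Proof.
move=> [s sP] xA; exists (\sum_(a <- s) pickle a).+1 => n Nn.
pose y : 'rV[C]_n := \row_i (if pickle_inv i is Some a then x a else 0).
have yv i : ~~ valid i -> (if pickle_inv i is Some a then x (a : Zd) else 0) = 0.
  by rewrite /valid; case: (pickle_inv i) => // a /xA.
exists y; last first.
  rewrite normsq_comb; apply: eq_bigr => i _; rewrite mxE.
  by case: (boolP (valid i)) => vi; rewrite ?mulr1// yv// normr0 expr0n mulr0.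
apply/funext => a; rewrite /comb; have [xa|xa] := eqVneq (x a) 0.
  rewrite xa big1// => i _; rewrite mxE /bas; case E : (pickle_inv i) => [b|]; last by rewrite mulr0.
  rewrite (inj_eq Some_inj); case: eqP => [->|_]; first by rewrite xa mul0r.
  by rewrite mulr0.
have sa : a \in s by apply: contraNT xa => /sP ->.
have an : (pickle a < n)%N.
  by apply: leq_trans Nn; rewrite ltnS (big_rem a sa) /= leq_addr.
have pa : pos A a by apply: contraNT xa => /xA ->.
rewrite (bigD1 (Ordinal an))//= big1 ?addr0 => [|i ia].
  by rewrite mxE /bas /= pickleK_inv eqxx pa mulr1.
rewrite /bas; case: eqP => [E|_]; last by rewrite mulr0.
have := @pickle_invK Zd i; rewrite /oapp E => ai.
by case/eqP: ia; apply/val_inj => /=.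
Qed.

End FiniteSup.

(** * The kernel family and the theorem *)

Section Family.
Local Open Scope classical_set_scope.
Local Open Scope ring_scope.
Variables (R : realType) (d : nat).
Local Notation C := R[i].
Local Notation Zd := (Zd d).
Local Notation npos := (pos [set: 'I_d]).
Local Notation Sz := (@Szego C d).

(** * The extremal kernel of a polynomial symbol *)

Section Polynomial.
Variables (P : seq (C * Zd)) (rho : C).
Hypothesis P_nonneg : nonneg P.
Hypothesis rho01 : 0 <= rho < 1.
Hypothesis P_contr : forall x, finsup x -> normsq (conv P x) <= rho ^+ 2 * normsq x.

Lemma conv_normsq_le x : finsup x -> normsq (conv P x) <= normsq x.
Proof.
move=> fx; apply: le_trans (P_contr fx) _; have /andP[r0 r1] := rho01.
by rewrite ler_piMl ?normsq_ge0// exprn_ile1// ltW.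
Qed.

Section Points.
Variables (n : nat) (p : 'I_n -> 'rV[C]_d) (v : 'I_n -> C).
Hypothesis pD : forall i, polydisk (p i).

(** After the square is completed, both terms of the difference are nonnegative, the second because
    [P] contracts. *)
Lemma Val_le_Szego x : finsup x -> Val P p v x <= qf Sz p v.
Proof.
move=> fx; apply: tends_le (tends_cst \oo (Val P p v x)) (tends_Szego_trunc (v := v) pD) _.
have [M MP] := finsup_bounded (finsup_conv P fx).
exists M => // N /= MN; rewrite -subr_ge0 Szego_sub_Val//; last first.
  by move=> a pa ga; exact: box_le MN (MP a pa ga).
by rewrite addr_ge0 ?residue_ge0// subr_ge0 conv_normsq_le.
Qed.

Lemma Val_shift_Szego j x : finsup x ->
  qf Sz p (shift_coef p j v) - Val P p (shift_coef p j v) (fun a => x (a + unit_vec j)) <=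
  qf Sz p v - Val P p v x.
Proof.
move=> fx.
have l1 : tends \oo (fun M => Szego_trunc p M (shift_coef p j v) -
      Val P p (shift_coef p j v) (fun a => x (a + unit_vec j)))
    (qf Sz p (shift_coef p j v) -
      Val P p (shift_coef p j v) (fun a => x (a + unit_vec j))).
  by apply: tendsB; [exact: tends_Szego_trunc|exact: tends_cst].
have l2 : tends \oo (fun M => Szego_trunc p M v - Val P p v x)
    (qf Sz p v - Val P p v x).
  by apply: tendsB; [exact: tends_Szego_trunc|exact: tends_cst].
have l2' : tends \oo (fun M => Szego_trunc p M.+1 v - Val P p v x)
    (qf Sz p v - Val P p v x).
  apply/tendsP => e e0; have [N _ NP] := (tendsP _ _).1 l2 e e0.
  by exists N => // M /= NM; apply: NP => /=; exact: leqW.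
apply: tends_le l1 l2' _.
have fc := finsup_conv P fx.
have [M1 M1P] := finsup_bounded fc.
have [M2 M2P] := finsup_bounded (finsup_shift (unit_vec j) fc).
exists (M1 + M2)%N => // N /= MN; apply: Val_shift => // a pa ga.
  by apply: box_le (M1P a pa ga); apply: leq_trans MN; rewrite leq_addr.
by apply: box_le (M2P a pa ga); apply: leq_trans MN; rewrite leq_addl.
Qed.

Lemma Val_le_Szego_eval w : finsup w -> supported [set: 'I_d] w ->
  Val P p v w <= qf Sz p (eval_coef P p v).
Proof.
move=> fw wN; apply: tends_le (tends_cst \oo _) (tends_Szego_trunc pD) _.
have [M MP] := finsup_bounded fw.
exists M => // N /= MN; apply: Val_supported_le => // a pa wa.
exact: box_le MN (MP a pa wa).
Qed.

Lemma Szego_eval_le c :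
  (forall w, finsup w -> supported [set: 'I_d] w -> Val P p v w <= c) ->
  qf Sz p (eval_coef P p v) <= c.
Proof.
move=> h; apply: tends_le (tends_Szego_trunc pD) (tends_cst \oo c) _.
apply: filterS filterT => M _ /=; rewrite -Val_Szego_trunc//; apply: h.
  exact: finsup_box.
by move=> a na; case: ifP => // /box_pos; rewrite (negbTE na).
Qed.

End Points.

Definition is_sup_kernel (A : {set 'I_d}) (J : kernel C d) :=
  forall n (p : 'I_n -> 'rV[C]_d) (v : 'I_n -> C), (forall i, polydisk (p i)) ->
  (forall x, finsup x -> supported A x -> Val P p v x <= qf J p v) /\
  (forall c, (forall x, finsup x -> supported A x -> Val P p v x <= c) -> qf J p v <= c).

(** Each element of H_A occurs at all large levels, so the limit of the level kernels is an upper
    bound; each level value is bounded by a value of [Val] on H_A, so it is the least one. *)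
Lemma sup_kernel_exists A : exists J, is_sup_kernel A J.
Proof.
have [U UU oU] := nat_ultrafilter.
pose Jn m : kernel C d := level_kernel P A m.
have Jn_ge0 m n (p : 'I_n -> 'rV[C]_d) v : 0 <= qf (Jn m) p v.
  rewrite qf_level_kernel.
  apply: le_trans (quad_le (gram_herm P A m) (gram_pos A rho01 P_contr (n := m)) _ 0).
  by rewrite /quad !mul0mx /adj map_mx0 trmx0 mulmx0 !mxE subr0 addr0.
have Jn_le m n (p : 'I_n -> 'rV[C]_d) v : (forall i, polydisk (p i)) ->
    qf (Jn m) p v <= qf Sz p v.
  move=> pD; have [y yP] := level_kernel_attained A rho01 P_contr m p v.
  exact/(le_trans yP)/Val_le_Szego/finsup_comb.
have /choice [J JP] (zw : 'rV[C]_d * 'rV[C]_d) : exists l : C,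
    polydisk zw.1 -> polydisk zw.2 -> tends U (fun m => Jn m zw.1 zw.2) l.
  have [[zD wD]|nD] := EM (polydisk zw.1 /\ polydisk zw.2); last first.
    by exists 0 => zD wD; case: nD.
  have Jb m n (p : 'I_n -> 'rV[C]_d) v : (forall i, polydisk (p i)) ->
    0 <= qf (Jn m) p v <= qf Sz p v by move=> pD; rewrite Jn_ge0 Jn_le.
  have [l lP] := ultra_cvg (UU := UU) (fun m => kernel_bound (Jb m) zD wD).
  by exists l.
exists (fun z w => J (z, w)) => n p v pD.
have Jlim : tends U (fun m => qf (Jn m) p v) (qf (fun z w => J (z, w)) p v).
  by apply: tends_qf => i j; exact: (JP (p i, p j) (pD i) (pD j)).
split=> [x fx xA|c cP].
  apply: tends_le (tends_cst U (Val P p v x)) Jlim _.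
  have [N NP] := comb_cover fx xA; apply: oU; exists N => // m /= /NP[y <- yN].
  exact: (level_kernel_ge rho01 P_contr).
apply: tends_le Jlim (tends_cst U c) _; apply: filterS filterT => m _ /=.
have [y yP] := level_kernel_attained A rho01 P_contr m p v.
by apply: le_trans yP _; apply: cP; [exact: finsup_comb|exact: supported_comb].
Qed.

End Polynomial.

(* The five inequalities express, for the form of [Szego - J T] as the kernel
   K_S with S the complement of T, and for that of [J T - F F^* Szego] as the
   kernel L_T, every requirement of the theorem. *)
Definition kernel_family (F : 'rV[C]_d -> C) (J : {set 'I_d} -> kernel C d) :=
  forall n (p : 'I_n -> 'rV[C]_d) (v : 'I_n -> C), (forall i, polydisk (p i)) ->
  let S := fun v : 'I_n -> C => qf Sz p v in
  let times_F := fun (v : 'I_n -> C) i => v i * F (p i) in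
  [/\ forall T, S (times_F v) <= qf (J T) p v <= S v,
      forall (T : {set 'I_d}) j, j \notin T ->
        S (shift_coef p j v) - qf (J T) p (shift_coef p j v) <= S v - qf (J T) p v,
      forall (T : {set 'I_d}) j, j \in T ->
        qf (J T) p (shift_coef p j v) - S (times_F (shift_coef p j v)) <=
        qf (J T) p v - S (times_F v),
      forall T T' : {set 'I_d}, T :|: T' = finset.setT ->
        qf (J T) p v + qf (J T') p v <= S v + S (times_F v)
    & forall T T' : {set 'I_d}, T' \subset T -> qf (J T) p v <= qf (J T') p v].

Lemma polynomial_family (P : seq (C * Zd)) (rho : C) : nonneg P -> 0 <= rho < 1 ->
  (forall x, finsup x -> normsq (conv P x) <= rho ^+ 2 * normsq x) ->
  exists J, kernel_family (poly_eval P) J.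
Proof.
move=> Pn rho01 Pc.
have /choice [J JP] A := sup_kernel_exists rho01 Pc A.
exists J => n p v pD S timesF.
have le_sup T u x (fx : finsup x) (xT : supported T x) : Val P p u x <= qf (J T) p u.
  exact: (JP T n p u pD).1.
have sup_le T u c : (forall x, finsup x -> supported T x -> Val P p u x <= c) ->
    qf (J T) p u <= c by exact: (JP T n p u pD).2.
(* The H^2 part of [x] and the rest. Multiplication by [P] keeps the H^2 part in H^2, so [Val] is
   additive on this splitting. *)
pose on (x : Zd -> C) a := if npos a then x a else 0.
pose offN (x : Zd -> C) a := if npos a then 0 else x a.
have on_fin x : finsup x -> finsup (on x) by move=> fx; exact: finsup_if.
have of_fin x : finsup x -> finsup (offN x).
  by move=> fx; apply: finsup_sub fx _ => a; rewrite /offN => ->; rewrite if_same.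
have on_supp x : supported [set: 'I_d] (on x) by move=> a /negbTE; rewrite /on => ->.
have of_supp T x : supported T x -> supported T (offN x).
  by move=> xT a /xT; rewrite /offN => ->; rewrite if_same.
have supp_sub (T T' : {set 'I_d}) x : T \subset T' -> supported T' x -> supported T x.
  by move=> TT xT a na; apply: xT; apply: contra na; exact: pos_sub.
have suppT T x : supported [set: 'I_d] x -> supported T x.
  by apply: supp_sub; exact: finset.subsetT.
have add_on u w x : finsup w -> finsup x -> supported [set: 'I_d] w ->
    (forall a, npos a -> x a = 0) ->
    Val P p u (fun a => w a + x a) = Val P p u w + Val P p u x.
  move=> fw fx wN x0; apply: Val_add => // a.
    by case: (boolP (npos a)) => [/x0|/wN] ->; [right|left].
  by move=> na; left; exact: (supported_conv Pn wN).
have split_on u x : finsup x -> Val P p u x = Val P p u (on x) + Val P p u (offN x).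
  move=> fx; rewrite -(add_on u (on x) (offN x) (on_fin x fx) (of_fin x fx) (on_supp x)).
    by congr Val; apply/funext => a; rewrite /on /offN; case: ifP; rewrite ?addr0 ?add0r.
  by move=> a pa; rewrite /offN pa.
have add_supp T x y : finsup x -> finsup y -> supported T x -> supported T y ->
    supported T (fun a => x a + y a).
  by move=> fx fy xT yT a na; rewrite xT// yT// addr0.
split.
- move=> T; apply/andP; split.
    by apply: Szego_eval_le => // w fw wN; apply: (le_sup _ _ _) => //; exact: suppT.
  by apply: (sup_le _ _) => x fx _; exact: (Val_le_Szego rho01 Pc).
- move=> T j jT; rewrite lerBrDr -lerBrDl; apply: (sup_le _ _) => x fx xT.
  rewrite lerBrDr -lerBrDl.
  apply: le_trans _ (Val_shift_Szego P v pD j fx).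
  rewrite lerD2l lerN2; apply: (le_sup _ _ _); first exact: finsup_shift.
  move=> a na; apply: xT; apply: contra na => /posP h; apply/posP => i iT.
  have := h i iT; rewrite !ffunE; case: eqP => [ij|_]; last by rewrite addr0.
  by rewrite -ij iT in jT.
- move=> T j jT; rewrite lerBlDr; apply: (sup_le _ _) => x fx xT.
  rewrite (split_on _ _ fx) addrC; apply: lerD; last first.
    by apply: Val_le_Szego_eval => //; exact: on_fin.
  have fu := of_fin x fx; have uT := of_supp T x xT.
  rewrite -(Val_unshift Pn p v jT fu uT) lerBrDr -lerBrDl.
  (* Any [w] in H^2 can be added to the forward shift of [offN x] without cross terms, and the sum
     is a competitor in H_T; the supremum over [w] supplies the term [S (timesF v)]. *)
  apply: Szego_eval_le => // w fw wN; rewrite lerBrDr.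
  have fs := finsup_shift (- unit_vec j) fu.
  rewrite -(add_on v w _ fw fs wN).
    apply: (le_sup _ _ _); first exact: finsupD.
    apply: add_supp => //; first exact: suppT.
    move=> a na; apply: uT; apply: contra na => h.
    by rewrite -(subrK (unit_vec j) a) posD ?pos_unit_vec.
  (* If [a] lies in the orthant and [a - unit_vec j] does not, the latter is negative in the
     direction [j] of [T], where [x] vanishes. *)
  move=> a pa; rewrite /offN; case: ifPn => // na; apply: xT; apply: contra na => h.
  by rewrite -(pos_unshift _ jT h) subrK.
(* The H^2 part of [x] accounts for [S (timesF v)]. The rest has no frequency in common with [y], as
   the cones of [T] and [T'] meet in the orthant; outside it their images under [P] are disjoint
   too, so [offN x + y] is one competitor, bounded by [S v]. *)
- move=> T T' TT; rewrite -lerBrDr; apply: (sup_le _ _) => x fx xT.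
  rewrite lerBrDr -lerBrDl; apply: (sup_le T' v) => y fy yT; rewrite lerBrDr.
  rewrite (split_on _ _ fx) addrCA [leLHS]addrC.
  apply: lerD; last by apply: Val_le_Szego_eval => //; exact: on_fin.
  have fu := of_fin x fx; have uT := of_supp T x xT.
  have posI a : pos T a -> pos T' a -> npos a.
    move=> /posP h /posP h'; apply/posP => i _.
    by have := finset.in_setT i; rewrite -TT finset.in_setU => /orP[/h|/h'].
  rewrite addrC -(@Val_add _ _ P _ p v (offN x) y fu fy).
  - by apply: (Val_le_Szego rho01 Pc) => //; exact: finsupD.
  - move=> a; case: (boolP (pos T a)) => [pa|/uT ->]; last by left.
    case: (boolP (pos T' a)) => [pa'|/yT ->]; last by right.
    by left; rewrite /offN posI.
  move=> a na; case: (boolP (pos T a)) => [pa|pa]; last first.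
    by left; exact: (supported_conv Pn uT).
  by right; apply: (supported_conv Pn yT); apply: contra na; exact: posI.
- move=> T T' TT; apply: (sup_le _ _) => x fx xT; apply: (le_sup _ _ _) => //; exact: supp_sub xT.
Qed.

(** The first inequality places all forms of [J k T] between 0 and that of Szego, so their entries
    are bounded and converge along an ultrafilter. *)
Lemma kernel_family_limit (f : 'rV[C]_d -> C) (F : nat -> 'rV[C]_d -> C)
    (J : nat -> {set 'I_d} -> kernel C d) :
  (forall k, kernel_family (F k) (J k)) ->
  (forall z, polydisk z -> tends \oo (fun k => F k z) (f z)) ->
  exists J, kernel_family f J.
Proof.
move=> JF Ff; have [U UU oU] := nat_ultrafilter.
have FfU z : polydisk z -> tends U (fun k => F k z) (f z).
  move=> /Ff /tendsP h; apply/tendsP => e e0; apply: oU; exact: h.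
have S_F n (p : 'I_n -> 'rV[C]_d) v (g : 'rV[C]_d -> C) :
    qf Sz p (fun i => v i * g (p i)) = qf (fun z w => g z * (g w)^* * Sz z w) p v.
  by rewrite qf_coef.
have S_lim n (p : 'I_n -> 'rV[C]_d) v : (forall i, polydisk (p i)) ->
    tends U (fun k => qf Sz p (fun i => v i * F k (p i))) (qf Sz p (fun i => v i * f (p i))).
  move=> pD; rewrite S_F (_ : (fun k => _) =
    (fun k => qf (fun z w => F k z * (F k w)^* * Sz z w) p v)); last first.
    by apply/funext => k; rewrite S_F.
  apply: tends_qf => i j; apply: tendsM; last exact: tends_cst.
  by apply: tendsM; [exact: FfU|apply: tends_conj; exact: FfU].
have psd_Sz n (p : 'I_n -> 'rV[C]_d) v : (forall i, polydisk (p i)) -> 0 <= qf Sz p v.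
  move=> pD; apply: tends_ge0 (tends_Szego_trunc (v := v) pD) _.
  apply: filterS filterT => M _ /=; apply: fsum_ge0 => [|a]; first exact: finsup_box.
  by case: ifP => // _; exact: exprn_ge0.
have /choice [J' JP] (tzw : {set 'I_d} * ('rV[C]_d * 'rV[C]_d)) : exists l : C,
    polydisk tzw.2.1 -> polydisk tzw.2.2 ->
    tends U (fun k => J k tzw.1 tzw.2.1 tzw.2.2) l.
  case: tzw => T [z w] /=.
  have [[zD wD]|nD] := EM (polydisk z /\ polydisk w); last first.
    by exists 0 => zD wD; case: nD.
  have Jb k n (p : 'I_n -> 'rV[C]_d) v : (forall i, polydisk (p i)) ->
      0 <= qf (J k T) p v <= qf Sz p v.
    move=> pD; have [/(_ T) /andP[h1 h2] _ _ _ _] := JF k n p v pD.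
    by rewrite h2 andbT; apply: le_trans h1; exact: psd_Sz.
  have [l lP] := ultra_cvg (UU := UU) (fun k => kernel_bound (Jb k) zD wD).
  by exists l.
exists (fun T z w => J' (T, (z, w))) => n p v pD S timesf.
have J_lim T u : tends U (fun k => qf (J k T) p u) (qf (fun z w => J' (T, (z, w))) p u).
  by apply: tends_qf => i j; exact: (JP (T, (p i, p j)) (pD i) (pD j)).
have S_cst u : tends U (fun=> S u) (S u) by exact: tends_cst.
have S_limU u : tends U (fun k => S (fun i => u i * F k (p i))) (S (timesf u)).
  exact: S_lim.
split.
- move=> T; apply/andP; split.
    apply: tends_le (S_limU v) (J_lim T v) _; apply: filterS filterT => k _ /=.
    by have [/(_ T) /andP[]] := JF k n p v pD.
  apply: tends_le (J_lim T v) (S_cst v) _; apply: filterS filterT => k _ /=.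
  by have [/(_ T) /andP[]] := JF k n p v pD.
- move=> T j jT; apply: tends_le (tendsB (S_cst _) (J_lim T _)) (tendsB (S_cst v) (J_lim T v)) _.
  apply: filterS filterT => k _ /=.
  by have [_ h _ _ _] := JF k n p v pD; exact: h.
- move=> T j jT; apply: tends_le (tendsB (J_lim T _) (S_limU _)) (tendsB (J_lim T v) (S_limU v)) _.
  apply: filterS filterT => k _ /=.
  by have [_ _ h _ _] := JF k n p v pD; exact: h.
- move=> T T' TT.
  apply: tends_le (tendsD (J_lim T v) (J_lim T' v)) (tendsD (S_cst v) (S_limU v)) _.
  apply: filterS filterT => k _ /=.
  by have [_ _ _ h _] := JF k n p v pD; exact: h.
- move=> T T' TT; apply: tends_le (J_lim T v) (J_lim T' v) _.
  apply: filterS filterT => k _ /=.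
  by have [_ _ _ _ h] := JF k n p v pD; exact: h.
Qed.

Lemma holomorphic_family (f : 'rV[C]_d -> C) :
  holomorphic_on (@polydisk C d) f -> (forall z, polydisk z -> `|f z| <= 1) ->
  exists J, kernel_family f J.
Proof.
move=> hf f1; have [P [Pn [Pc Pf]]] := torus_poly_approx hf f1.
have /choice [J JP] k : exists J, kernel_family (poly_eval (P k)) J.
  by have [rho rho01 rhoP] := Pc k; exact: polynomial_family (Pn k) rho01 rhoP.
apply: kernel_family_limit JP _ => z zD; apply/tendsP => e e0.
by have [N NP] := Pf z zD e e0; exists N.
Qed.

End Family.

Theorem theorem1p3 (R : realType) (d : nat) (hd : (2 <= d)%N)
    (f : 'rV[R[i]]_d -> R[i])
    (f_holo : holomorphic_on (@polydisk R[i] d) f)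
    (f_disk : forall z : 'rV[R[i]]_d, polydisk z -> `|f z| < 1) :
  exists K L : {set 'I_d} -> kernel R[i] d,
    [/\ (forall S : {set 'I_d}, S != finset.set0 -> S \proper finset.setT ->
           [/\ psd_kernel (K S), contractive S (K S),
               psd_kernel (L S) & contractive S (L S)]),
        (forall S T : {set 'I_d},
           S != finset.set0 -> T != finset.set0 ->
           S :&: T = finset.set0 -> S :|: T = finset.setT ->
           [/\ (forall z w : 'rV[R[i]]_d, polydisk z -> polydisk w ->
                  (1 - f z * (f w)^*)
                    / \prod_(j < d) (1 - z ord0 j * (w ord0 j)^*)
                  = K S z w + L T z w),
               (forall z w : 'rV[R[i]]_d, polydisk z -> polydisk w ->
                  K T z w - L T z w = K S z w - L S z w)
             & kernel_ge (K S) (L S)])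
      & (forall S S' : {set 'I_d},
           S != finset.set0 -> S \proper finset.setT ->
           S' != finset.set0 -> S' \proper finset.setT ->
           S \subset S' -> kernel_ge (K S) (K S'))].
Proof.
have [J JP] := holomorphic_family f_holo (fun z zD => ltW (f_disk z zD)).
pose Sz := @Szego R[i] d.
pose fSz : kernel R[i] d := fun z w => f z * (f w)^* * Sz z w.
(* In the decomposition [J T] cancels, and [K S - L S] is [Sz + fSz - J S - J (~: S)], symmetric
   under complement; only the inequalities need the family. *)
exists (fun S z w => Sz z w - J (~: S) z w), (fun S z w => J S z w - fSz z w).
have ffE n (p : 'I_n -> 'rV[R[i]]_d) v : qf fSz p v = qf Sz p (fun i => v i * f (p i)).
  by rewrite qf_coef.
split.
- move=> S _ _; split.
  + apply: psd_kernelP => n p v pD; rewrite qfB subr_ge0.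
    by have [/(_ (~: S)) /andP[]] := JP n p v pD.
  + move=> j jS; apply: psd_kernelP => n p v pD; rewrite qf_shift !qfB subr_ge0.
    by have [_ h _ _ _] := JP n p v pD; apply: h; rewrite finset.in_setC jS.
  + apply: psd_kernelP => n p v pD; rewrite qfB subr_ge0 ffE.
    by have [/(_ S) /andP[]] := JP n p v pD.
  + move=> j jS; apply: psd_kernelP => n p v pD; rewrite qf_shift !qfB subr_ge0 !ffE.
    by have [_ _ h _ _] := JP n p v pD; exact: h.
- move=> S T _ _ ST0 STT.
  have TE : T = ~: S.
    apply/setP => i; have /setP /(_ i) := ST0; have /setP /(_ i) := STT.
    by rewrite !inE; case: (i \in S); case: (i \in T).
  split=> [z w _ _|z w _ _|].
  + by rewrite TE /fSz /Sz /Szego mulrBl mul1r addrA subrK.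
  + by rewrite TE finset.setCK; ring.
  + apply: psd_kernelP => n p v pD; rewrite !qfB ffE.
    have [_ _ _ /(_ S (~: S) (finset.setUCr S)) h _] := JP n p v pD.
    by rewrite subr_ge0 lerBlDr addrAC lerBrDr.
- move=> S S' _ _ _ _ SS; apply: psd_kernelP => n p v pD; rewrite !qfB.
  rewrite subr_ge0 lerD2l lerN2.
  by have [_ _ _ _ h] := JP n p v pD; apply: h; rewrite finset.setCS.
Qed.
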